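(* Let $\Omega\subset\mathbb R^n$ be a domain, $1\le m\le n$, and $0<f\in C^{k,\alpha}(\Omega)$ with $k\ge2$, $\alpha\in(0,1)$. Let $E\subset\subset\Omega$ be a closed subset of a $C^{1,1}$-submanifold $M$ of $\mathbb R^n$ of dimension $l<n$. Let $u\in C^2(\Omega\setminus E)\cap C(\overline\Omega)$ be an $m$-admissible solution of $F_m(D^2u)=f(x)$ in $\Omega\setminus E$ such that the Dirichlet problem $$F_m(D^2v)=f(x)\ \text{ in }\Omega,\qquad v=\varphi\ \text{ on }\partial\Omega,$$ with $\varphi=u_{|\partial\Omega}$, has an $m$-admissible solution $v\in C^2(\Omega)\cap C(\overline\Omega)$. If for every $x\in E$ there is a continuous curve $\gamma$ through $x$ which is differentiable at $x$ and transversal (i.e. not tangential) to $M$ at $x$, such that $u$ is differentiable at $x$ along $\gamma$, then $E$ is removable, i.e. $u=v$ and $u\in C^2(\Omega)$.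
   Context: A domain is an open, connected, bounded subset of $\mathbb R^n$. $E\subset\subset\Omega$ means that $\overline E$ is a compact subset of $\Omega$. $C^{k,\alpha}(\Omega)$ denotes functions whose $k$-th derivatives are locally $\alpha$-Hölder continuous in $\Omega$. Submanifolds are embedded. For $w\in C^2$, $\lambda(D^2w)=(\lambda_1,\dots,\lambda_n)$ is the vector of eigenvalues of the Hessian matrix $D^2w$, $S_k(\lambda)=\sum_{1\le i_1<\dots<i_k\le n}\lambda_{i_1}\cdots\lambda_{i_k}$, and $F_m(D^2w)=S_m(\lambda(D^2w))^{1/m}$. A $C^2$ function $w$ on an open set is $m$-admissible if $S_k(\lambda(D^2w))>0$ there for each $k=1,\dots,m$. The curve condition means: $\gamma:(-\delta,\delta)\to\mathbb R^n$ is continuous, $\gamma(0)=x$, the derivative $\gamma'(0)$ exists and $\gamma'(0)\notin T_xM$ (the linear tangent space of $M$ at $x$; in particular $\gamma'(0)\neq0$); and $u$ is differentiable at $x$ along $\gamma$ if $t\mapsto u(\gamma(t))$ is differentiable at $t=0$. *)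

(* Defs.v *)
From HB Require Import structures.
From mathcomp Require Import all_boot all_order all_algebra.
From mathcomp Require Import all_classical all_reals all_analysis.
Set Implicit Arguments. Unset Strict Implicit. Unset Printing Implicit Defensive.
Import Order.TTheory GRing.Theory Num.Theory.
Import numFieldNormedType.Exports.
Local Open Scope classical_set_scope.
Local Open Scope ring_scope.

(* R^n is 'rV[R]_n with its library (sup-norm) structure. A function on a
   subset U of R^n is represented by a total function, whose values outside U
   play no role. *)

Section Defs.
Context {R : realType}.

Definition basis_vec (n : nat) (i : 'I_n) : 'rV[R]_n := delta_mx 0 i.

Definition partial (n : nat) (s : seq 'I_n) (w : 'rV[R]_n -> R) :
    'rV[R]_n -> R :=
  foldr (fun i g x => 'D_(basis_vec i) g x) w s.

(* C^k(U) for U open; derivability is required explicitly because 'D_v is a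
   total operator. *)
Definition is_Ck (n k : nat) (U : set 'rV[R]_n) (w : 'rV[R]_n -> R) : Prop :=
  forall s : seq 'I_n,
    ((size s <= k)%N -> {in U, continuous (partial s w)}) /\
    ((size s < k)%N ->
      forall (i : 'I_n) x, U x -> derivable (partial s w) x (basis_vec i)).

Definition locally_holder (n : nat) (a : R) (U : set 'rV[R]_n)
    (g : 'rV[R]_n -> R) : Prop :=
  forall x, U x -> exists r C : R, 0 < r /\
    forall y z, U y -> U z -> ball x r y -> ball x r z ->
      `|g y - g z| <= C * `|y - z| `^ a.

(* C^{k,a}(U); a = 1 gives locally Lipschitz k-th derivatives. *)
Definition is_Ck_holder (n k : nat) (a : R) (U : set 'rV[R]_n)
    (w : 'rV[R]_n -> R) : Prop :=
  is_Ck k U w /\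
  forall s : seq 'I_n, size s = k -> locally_holder a U (partial s w).

Definition hessian (n : nat) (w : 'rV[R]_n -> R) (x : 'rV[R]_n) : 'M[R]_n :=
  \matrix_(i, j) partial [:: i; j] w x.

(* The vector of eigenvalues, with multiplicity, in an arbitrary chosen order.
   It exists for every real symmetric A; the default value 0 is used only for
   a matrix whose characteristic polynomial does not split over R. *)
Definition eigenvalues (n : nat) (A : 'M[R]_n) : 'rV[R]_n :=
  xget 0 [set lam : 'rV[R]_n |
            char_poly A = \prod_(i < n) ('X - (lam 0 i)%:P)].

Definition S_ (k n : nat) (lam : 'rV[R]_n) : R :=
  \sum_(I : {set 'I_n} | #|I| == k) \prod_(i in I) lam 0 i.

(* powR is the usual real power on the positive reals, the only place where
   F_ is used below. *)
Definition F_ (m n : nat) (A : 'M[R]_n) : R :=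
  S_ m (eigenvalues A) `^ (m%:R^-1).

Definition admissible (n m : nat) (U : set 'rV[R]_n) (w : 'rV[R]_n -> R) :
    Prop :=
  is_Ck 2 U w /\
  forall x, U x -> forall k : nat, (1 <= k <= m)%N ->
    0 < S_ k (eigenvalues (hessian w x)).

Definition admissible_solution (n m : nat) (f : 'rV[R]_n -> R)
    (U : set 'rV[R]_n) (w : 'rV[R]_n -> R) : Prop :=
  admissible m U w /\ forall x, U x -> F_ m (hessian w x) = f x.

Definition domain (n : nat) (Omega : set 'rV[R]_n) : Prop :=
  [/\ open Omega, connected Omega & bounded_set Omega].

Definition boundary (n : nat) (Omega : set 'rV[R]_n) : set 'rV[R]_n :=
  closure Omega `\` interior Omega.

Definition dirichlet_solution (n m : nat) (f : 'rV[R]_n -> R)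
    (Omega : set 'rV[R]_n) (phi v : 'rV[R]_n -> R) : Prop :=
  [/\ admissible_solution m f Omega v,
      {within closure Omega, continuous v} &
      forall x, boundary Omega x -> v x = phi x].

Definition compactly_contained (n : nat) (E Omega : set 'rV[R]_n) : Prop :=
  compact (closure E) /\ closure E `<=` Omega.

Definition is_C11_map (n p : nat) (U : set 'rV[R]_n)
    (Phi : 'rV[R]_n -> 'rV[R]_p) : Prop :=
  forall i : 'I_p, is_Ck_holder 1 1 U (fun y => Phi y 0 i).

(* An embedded C^{1,1} submanifold of dimension l: locally a C^{1,1}
   diffeomorphism Phi : U -> V of open sets of R^n, with inverse Psi, takes M
   to the slice R^l x {0}. *)
Definition C11_submanifold (n l : nat) (M : set 'rV[R]_n) : Prop :=
  forall p, M p ->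
    exists (U V : set 'rV[R]_n) (Phi Psi : 'rV[R]_n -> 'rV[R]_n),
      [/\ open U, open V & U p] /\
      (forall y, U y -> V (Phi y) /\ Psi (Phi y) = y) /\
      (forall z, V z -> U (Psi z) /\ Phi (Psi z) = z) /\
      is_C11_map U Phi /\ is_C11_map V Psi /\
      (forall y, U y -> (M y <-> forall i : 'I_n, (l <= i)%N -> Phi y 0 i = 0)).

(* T_x M: the velocities at x of C^1 curves in M. *)
Definition tangent_space (n : nat) (M : set 'rV[R]_n) (x : 'rV[R]_n) :
    set 'rV[R]_n :=
  [set w | exists (eps : R) (c : R -> 'rV[R]_n),
     0 < eps /\
     (forall t, `|t| < eps ->
        [/\ M (c t), derivable c t 1 & continuous_at t (derive1 c)]) /\
     c 0 = x /\ derive1 c 0 = w].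

Definition differentiable_along_transversal_curve (n : nat)
    (M : set 'rV[R]_n) (u : 'rV[R]_n -> R) (x : 'rV[R]_n) : Prop :=
  exists (delta : R) (gamma : R -> 'rV[R]_n),
    0 < delta /\
    (forall t, `|t| < delta -> continuous_at t gamma) /\
    gamma 0 = x /\
    derivable gamma 0 1 /\
    ~ tangent_space M x (derive1 gamma 0) /\
    derivable (u \o gamma) 0 1.

End Defs.

(* Main.v *)
Require Import Defs.
From HB Require Import structures.
From mathcomp Require Import all_boot all_order all_algebra.
From mathcomp Require Import all_classical all_reals all_analysis.
From mathcomp Require Import fraction complex spectral ring lra.
Import Order.TTheory GRing.Theory Num.Theory.
Import numFieldNormedType.Exports.
Local Open Scope ring_scope.

(** The conclusion is a comparison principle that ignores E: when w1 and w2 are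
    u and v in either order, w1 <= w2 on the closure of Omega ([comparison]).

    Suppose w1 - w2 is positive somewhere.  It vanishes on the boundary, so for
    a small eps > 0 the function G = w1 - w2 + eps |x|^2 attains its maximum W
    over the closure at a point x0 of Omega.  Off E, no function
    w1 - w2 + c |x|^2 + (affine) with c > 0 has a local maximum
    ([no_interior_max]): the second-order condition would make
    D^2 w2 - D^2 w1 positive definite, and since S_m is strictly increasing on
    the Garding cone ([sigma_mono]) the two values of F_m would differ, while
    both are equal to f.  So x0 belongs to E.

    Transversality gives a vector p normal to M at x0 with p . gamma'(0) <> 0,
    and because M is of class C^{1,1}, p . (x - x0) = O(|x - x0|^2) on M
    ([transversal_normal]).  Tilt G by a small linear term while giving up half
    of the convexity: G2 = G - (eps/2) |x - x0|^2 + tau p . (x - x0).  For small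
    tau this is at most W on M and on the boundary of a small ball around x0,
    and it keeps the term (eps/2) |x|^2 which forbids local maxima off E.  Hence
    G2 <= W = G2 x0 on the ball.  Now G and G2 both have a local maximum at time
    0 along gamma, where both are differentiable, and the difference of their
    vanishing derivatives is tau p . gamma'(0): a contradiction.

    Monotonicity of S_m is reduced to rank one.  A positive definite matrix is a
    positive combination of matrices z^T z, and in an orthonormal eigenbasis of
    A, with eigenvalues lam and coordinates y of z, adding c z^T z to A
    increases S_k by c times the sum over i of y_i^2 e_{k-1} (lam without
    lam_i).  The truncated symmetric functions are positive on the Garding cone
    by Newton's inequality ([esf_garding], [esf_newton]). *)

(** * Elementary symmetric functions *)

Definition esf_poly {F : comNzRingType} {n : nat} (lam : 'rV[F]_n)
    (A : {set 'I_n}) : {poly F} :=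
  \prod_(i in A) (1 + lam 0 i *: 'X).

(** The elementary symmetric function of degree k of the lam_i with i in A, read
    off as a coefficient so that recurrences come from polynomial products. *)
Definition esf {F : comNzRingType} {n : nat} (lam : 'rV[F]_n)
    (A : {set 'I_n}) (k : nat) : F := (esf_poly lam A)`_k.

Lemma esf_polyD1 {F : comNzRingType} {n : nat} (lam : 'rV[F]_n)
    (A : {set 'I_n}) (i : 'I_n) : i \in A ->
  esf_poly lam A = (1 + lam 0 i *: 'X) * esf_poly lam (A :\ i).
Proof. by move=> iA; rewrite /esf_poly (big_setD1 i). Qed.

Lemma esf0 {F : comNzRingType} {n : nat} (lam : 'rV[F]_n) (A : {set 'I_n}) :
  esf lam A 0 = 1.
Proof.
rewrite /esf -horner_coef0 /esf_poly horner_prod big1 // => i _.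
by rewrite hornerD hornerZ hornerX hornerC mulr0 addr0.
Qed.

Lemma esfS {F : comNzRingType} {n : nat} (lam : 'rV[F]_n)
    (A : {set 'I_n}) (i : 'I_n) (k : nat) : i \in A ->
  esf lam A k.+1 = esf lam (A :\ i) k.+1 + lam 0 i * esf lam (A :\ i) k.
Proof.
move=> iA; rewrite /esf (esf_polyD1 _ _ _ iA) mulrDl mul1r.
by rewrite -scalerAl coefD coefZ coefXM.
Qed.

Lemma esf_polyE {F : comNzRingType} {n : nat} (lam : 'rV[F]_n)
    (A : {set 'I_n}) :
  esf_poly lam A =
  \sum_(J : {set 'I_n} | J \subset A) (\prod_(i in J) lam 0 i) *: 'X^#|J|.
Proof.
rewrite /esf_poly big_mkcond /=.
rewrite (eq_bigr (fun i => (if i \in A then lam 0 i else 0) *: 'X + 1));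
  last first.
  by move=> i _; case: ifP; rewrite ?scale0r ?add0r // addrC.
rewrite bigA_distr (bigID (fun J : {set 'I_n} => J \subset A)) /=.
rewrite [X in _ + X]big1 ?addr0 => [|J JA].
  apply: eq_bigr => J JA.
  rewrite -big_mkcond /= -prodr_const -scaler_prod.
  by apply: eq_bigr => i iJ; rewrite (fintype.subsetP JA _ iJ).
have /fintype.subsetPn[i iJ iA] := JA.
by rewrite (bigD1 i)//= iJ (negPf iA) scale0r mul0r.
Qed.

(** Euler's identity for homogeneous functions; both sides are coefficients of
    the derivative of [esf_poly]. *)
Lemma esf_euler {F : comNzRingType} {n : nat} (lam : 'rV[F]_n)
    (A : {set 'I_n}) (k : nat) :
  \sum_(i in A) lam 0 i * esf lam (A :\ i) k = esf lam A k.+1 *+ k.+1.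
Proof.
suff dE : (esf_poly lam A)^`() =
    \sum_(i in A) lam 0 i *: esf_poly lam (A :\ i).
  by rewrite /esf -coef_deriv dE coef_sum; apply: eq_bigr => i _; rewrite coefZ.
have [N] := ubnP #|A|; elim: N A => // N IH A.
have [->|[x xA]] := finset.set_0Vmem A.
  by rewrite /esf_poly !big_set0 poly.derivE.
rewrite ltnS (cardsD1 x) xA => /IH {}IH.
rewrite (esf_polyD1 _ _ _ xA) derivM IH (big_setD1 x xA) /=; congr (_ + _).
  by rewrite !poly.derivE add0r alg_polyC -mul_polyC.
rewrite mulr_sumr; apply: eq_bigr => i; rewrite finset.in_setD1 => /andP[ix iA].
rewrite -scalerAr; congr (_ *: _).
rewrite (@esf_polyD1 _ _ lam (A :\ i) x) ?finset.in_setD1 1?eq_sym ?ix//.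
by rewrite finset.setDDl finset.setUC -finset.setDDl.
Qed.

(** The i-th summand is lam_i^2 times the Newton difference of degree j for
    A without i (substitute [esfS]), which is what makes Newton's inequality
    provable by induction on the degree. *)
Lemma esf_newton_rec {F : comNzRingType} {n : nat} (lam : 'rV[F]_n)
    (A : {set 'I_n}) (j : nat) :
  (esf lam A j.+1 ^+ 2 - esf lam A j * esf lam A j.+2) *+ j.+2 =
  esf lam A j.+1 ^+ 2 +
  \sum_(i in A) (esf lam A j.+1 * (lam 0 i * esf lam (A :\ i) j)
     - esf lam A j * (lam 0 i * esf lam (A :\ i) j.+1)).
Proof.
rewrite sumrB -!mulr_sumr !esf_euler.
move: (esf _ _ j) (esf _ _ j.+1) (esf _ _ j.+2) => a b c; ring.
Qed.

(** Newton's inequality without its binomial factors, for reals of any sign. *)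
Lemma esf_newton {F : realDomainType} {n : nat} (lam : 'rV[F]_n)
    (A : {set 'I_n}) (k : nat) :
  esf lam A k * esf lam A k.+2 <= esf lam A k.+1 ^+ 2.
Proof.
elim: k A => [|k IH] A; rewrite -subr_ge0.
  rewrite -(@pmulrn_lge0 _ _ 2) // esf_newton_rec.
  rewrite addr_ge0 ?sqr_ge0// sumr_ge0// => i iA.
  rewrite !esf0 (esfS _ _ _ _ iA) esf0.
  move: (esf _ _ _) (lam 0 i) => p a; have := sqr_ge0 a; lra.
rewrite -(@pmulrn_lge0 _ _ k.+3) // esf_newton_rec.
rewrite addr_ge0 ?sqr_ge0// sumr_ge0// => i iA.
rewrite !(esfS _ _ _ _ iA).
have := IH (A :\ i); rewrite -subr_ge0 => /(mulr_ge0 (sqr_ge0 (lam 0 i))).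
move: (esf _ _ k) (esf _ _ k.+1) (esf _ _ k.+2) (lam 0 i) => p q r a h.
by rewrite (_ : _ - _ = a ^+ 2 * (q ^+ 2 - p * r)) //; ring.
Qed.

(** Discarding one variable costs one degree of positivity.  Let k + 1 be the
    first degree at which the truncated function is nonpositive, and p, q, r its
    values in degrees k, k + 1, k + 2: positivity of q + a p and r + a q then
    forces p r > q^2, against Newton's inequality. *)
Lemma esf_garding {F : realDomainType} {n : nat} (lam : 'rV[F]_n)
    (A : {set 'I_n}) (m : nat) :
  (forall k, (1 <= k <= m)%N -> 0 < esf lam A k) ->
  forall i k, i \in A -> (k < m)%N -> 0 < esf lam (A :\ i) k.
Proof.
move=> posA i k iA; elim: k => [|k IH] km; first by rewrite esf0.
have p_gt0 := IH (ltnW km).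
have := posA k.+1; have := posA k.+2; rewrite !(esfS _ _ _ _ iA) km (ltnW km).
move=> /(_ isT) h2 /(_ isT) h1.
have := esf_newton lam (A :\ i) k.
move: p_gt0 h1 h2.
move: (esf _ _ k) (esf _ _ k.+1) (esf _ _ k.+2) (lam 0 i) => p q r a.
move=> p_gt0 h1 h2 newton; rewrite ltNge; apply/negP => q_le0.
have : 0 < p * (r + a * q) by rewrite mulr_gt0.
have : 0 <= (q + a * p) * (- q) by rewrite mulr_ge0 ?oppr_ge0// ltW.
move: newton; lra.
Qed.

(** * Spectral theorem for real symmetric matrices *)

Lemma mulmx_trE {F : comNzRingType} {n : nat} (x y : 'rV[F]_n) :
  (x *m y^T) 0 0 = \sum_i x 0 i * y 0 i.
Proof. by rewrite !mxE; apply: eq_bigr => i _; rewrite !mxE. Qed.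

Lemma mulmx_tr_ge0 {F : realDomainType} {n : nat} (x : 'rV[F]_n) :
  0 <= (x *m x^T) 0 0.
Proof. by rewrite mulmx_trE sumr_ge0 // => i _; rewrite -expr2 sqr_ge0. Qed.

Lemma mulmx_tr_eq0 {F : realDomainType} {n : nat} (x : 'rV[F]_n) :
  ((x *m x^T) 0 0 == 0) = (x == 0).
Proof.
apply/eqP/eqP => [|->]; last by rewrite mul0mx mxE.
rewrite mulmx_trE => /eqP; rewrite psumr_eq0 => [/allP h|i _]; last first.
  by rewrite -expr2 sqr_ge0.
apply/rowP => i; rewrite mxE; apply/eqP.
by have := h i (mem_index_enum i); rewrite -expr2 expf_eq0.
Qed.

Lemma mulmx_tr_gt0 {F : realDomainType} {n : nat} (x : 'rV[F]_n) :
  x != 0 -> 0 < (x *m x^T) 0 0.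
Proof. by rewrite -mulmx_tr_eq0 lt_neqAle eq_sym mulmx_tr_ge0 andbT. Qed.

Lemma mulmx_trC {F : comNzRingType} {n : nat} (x y : 'rV[F]_n) :
  (x *m y^T) 0 0 = (y *m x^T) 0 0.
Proof. by rewrite -[x *m y^T]trmxK trmx_mul trmxK mxE. Qed.

(** A complex eigenvalue mu exists.  Pairing the real part a and the imaginary
    part b of an eigenvector against each other, symmetry gives
    Im(mu) (|a|^2 + |b|^2) = 0, so mu is real and a or b is an eigenvector. *)
Lemma sym_eigenvector {R : rcfType} {n : nat} (A : 'M[R]_n.+1) : A^T = A ->
  exists (q : 'rV[R]_n.+1) (a : R), (q *m q^T) 0 0 = 1 /\ q *m A = a *: q.
Proof.
move=> symA.
suff [q [a [q0 qA]]] : exists (q : 'rV[R]_n.+1) (a : R),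
    q != 0 /\ q *m A = a *: q.
  pose c := Num.sqrt ((q *m q^T) 0 0).
  have c_gt0 : 0 < c by rewrite sqrtr_gt0 mulmx_tr_gt0.
  exists (c^-1 *: q), a; split; last by rewrite -scalemxAl qA !scalerA mulrC.
  rewrite linearZ /= -scalemxAr -scalemxAl scalerA mxE.
  rewrite -(sqr_sqrtr (mulmx_tr_ge0 q)) -/c.
  by field; rewrite gt_eqF.
have [mu /eigenvalueP[w wA w0]] :=
  eigenvalue_closed (map_mx (real_complex R) A) (ltn0Sn n).
pose a := map_mx (@complex.Re R) w; pose b := map_mx (@complex.Im R) w.
pose s := complex.Re mu; pose t := complex.Im mu.
have entry j : \sum_k w 0 k * (A k j)%:C%C = mu * w 0 j.
  have := congr1 (fun x : 'rV_n.+1 => x 0 j) wA; rewrite !mxE => <-.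
  by apply: eq_bigr => k _; rewrite !mxE.
have aA : a *m A = s *: a - t *: b.
  apply/rowP => j; have := congr1 (@complex.Re R) (entry j).
  rewrite raddf_sum !mxE /s /t; case: mu {wA entry s t} => s t.
  case: (w 0 j) => x y /= <-; apply: eq_bigr => k _; rewrite !mxE.
  by case: (w 0 k) => x' y' /=; rewrite mulr0 subr0.
have bA : b *m A = s *: b + t *: a.
  apply/rowP => j; have := congr1 (@complex.Im R) (entry j).
  rewrite raddf_sum !mxE /s /t; case: mu {wA entry s t aA} => s t.
  case: (w 0 j) => x y /= <-; apply: eq_bigr => k _; rewrite !mxE.
  by case: (w 0 k) => x' y' /=; rewrite mulr0 add0r.
have ab0 : (a != 0) || (b != 0).
  apply: contraNT w0; rewrite negb_or !negbK => /andP[/eqP a0 /eqP b0].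
  apply/eqP/rowP => j.
  have := congr1 (fun x : 'rV_n.+1 => x 0 j) a0.
  have := congr1 (fun x : 'rV_n.+1 => x 0 j) b0.
  by rewrite !mxE; case: (w 0 j) => x y /= -> ->.
have t0 : t = 0.
  have abA : (a *m A *m b^T) 0 0 = (b *m A *m a^T) 0 0.
    by rewrite mulmx_trC trmx_mul symA mulmxA.
  move: abA; rewrite aA bA mulmxBl mulmxDl -!scalemxAl !mxE.
  have := mulmx_trC a b; rewrite mxE [in RHS]mxE => -> h.
  have : t * ((a *m a^T) 0 0 + (b *m b^T) 0 0) = 0.
    move: h; rewrite !mxE; lra.
  move/eqP; rewrite mulf_eq0 => /orP[/eqP //|].
  rewrite paddr_eq0 ?mulmx_tr_ge0// !mulmx_tr_eq0 => /andP[a0 b0].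
  by rewrite a0 b0 in ab0.
rewrite t0 scale0r subr0 in aA; rewrite t0 scale0r addr0 in bA.
by case/orP: ab0 => ?; [exists a, s|exists b, s].
Qed.

(** H is the reflection exchanging q and the first basis vector, or the identity
    if they coincide. *)
Lemma householder {F : realFieldType} {n : nat} (q : 'rV[F]_n.+1) :
  (q *m q^T) 0 0 = 1 ->
  exists H : 'M[F]_n.+1, H *m H^T = 1%:M /\ delta_mx 0 0 *m H = q.
Proof.
move=> q1; pose e : 'rV[F]_n.+1 := delta_mx 0 0; pose w := q - e.
have [w0|w0] := eqVneq w 0.
  exists 1%:M; rewrite trmx1 !mulmx1; split=> //.
  by apply/esym/eqP; rewrite -subr_eq0 -/e -/w w0.
pose s := (w *m w^T) 0 0; have s_gt0 : 0 < s by exact: mulmx_tr_gt0.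
have ee : (e *m e^T) 0 0 = 1 by rewrite -rowE !mxE.
have ew : (e *m w^T) 0 0 = - s / 2.
  have -> : s = 2 - 2 * (e *m q^T) 0 0.
    rewrite /s /w linearB /= mulmxBr !mulmxBl !mxE.
    move: q1 ee (mulmx_trC q e); rewrite !mxE => -> -> ->; ring.
  rewrite /w linearB /= mulmxBr.
  by move: ee; rewrite !mxE => ->; field.
pose P : 'M[F]_n.+1 := w^T *m w.
have eP : e *m P = (- s / 2) *: w.
  by rewrite mulmxA [_ *m w^T]mx11_scalar ew mul_scalar_mx.
have PP : P *m P = s *: P.
  rewrite {1}/P mulmxA -(mulmxA w^T) [w *m w^T]mx11_scalar -/s.
  by rewrite mul_mx_scalar -scalemxAl.
have PT : P^T = P by rewrite trmx_mul trmxK.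
exists (1%:M - (2 / s) *: P); split.
  have -> : (1%:M - (2 / s) *: P)^T = 1%:M - (2 / s) *: P.
    by rewrite -{2}PT -{2}(trmx1 _ n.+1); apply/matrixP => i j; rewrite !mxE.
  rewrite mulmxBl mul1mx mulmxBr mulmx1 -scalemxAr -scalemxAl PP !scalerA.
  apply/matrixP => i k; rewrite !mxE; field; by rewrite gt_eqF.
rewrite mulmxBr mulmx1 -scalemxAr -/e eP scalerA.
have -> : 2 / s * (- s / 2) = -1 by field; rewrite gt_eqF.
by rewrite scaleN1r opprK /w addrCA subrr addr0.
Qed.

(** Induction on the size: reflecting a unit eigenvector onto the first basis
    vector makes the matrix block diagonal. *)
Theorem sym_spectral {R : rcfType} {n : nat} (A : 'M[R]_n) : A^T = A ->
  exists (Q : 'M[R]_n) (lam : 'rV[R]_n),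
    Q *m Q^T = 1%:M /\ Q *m A *m Q^T = diag_mx lam.
Proof.
elim: n A => [|n IH] A symA.
  by exists 1%:M, 0; split; apply/matrixP; case.
have [q [a [q1 qA]]] := sym_eigenvector A symA.
have [H [HH eH]] := householder q q1.
pose B : 'M[R]_(1 + n) := H *m A *m H^T.
have symB : B^T = B by rewrite !trmx_mul trmxK symA mulmxA.
have rowB : delta_mx 0 0 *m B = a *: delta_mx 0 0 :> 'rV_n.+1.
  by rewrite /B !mulmxA eH qA -eH -!scalemxAl -mulmxA HH mulmx1.
have urB : ursubmx B = 0.
  apply/matrixP => i j; rewrite !mxE ord1.
  have := congr1 (fun x : 'rV_(1 + n) => x 0 (rshift 1 j)) rowB.
  rewrite -rowE !mxE; have -> : @lshift 1 n 0 = 0 by exact: val_inj.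
  by move=> ->; rewrite eqxx /= mulr0.
have dlB : dlsubmx B = 0 by rewrite -[B]symB -trmx_ursub urB trmx0.
have ulB : ulsubmx B = a%:M.
  apply/matrixP => i j; rewrite !mxE !ord1.
  have := congr1 (fun x : 'rV_(1 + n) => x 0 (lshift n 0)) rowB.
  rewrite -rowE !mxE; have -> : @lshift 1 n 0 = 0 by exact: val_inj.
  by move=> ->; rewrite eqxx /= mulr1.
have symB' : (drsubmx B)^T = drsubmx B by rewrite trmx_drsub symB.
have [Q [lam [QQ QBQ]]] := IH _ symB'.
pose P : 'M[R]_(1 + n) := block_mx 1%:M 0 0 Q.
have PT : P^T = block_mx 1%:M 0 0 Q^T by rewrite tr_block_mx !trmx0 trmx1.
have PP : P *m P^T = 1%:M.
  rewrite PT mulmx_block !mulmx0 !mul0mx !addr0 add0r mulmx1 QQ.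
  by rewrite -scalar_mx_block.
have PBP : P *m B *m P^T = diag_mx (row_mx a%:M lam).
  rewrite PT -[B]submxK urB dlB ulB !mulmx_block.
  rewrite !(mulmx0, mul0mx, addr0, add0r, mulmx1, mul1mx) QBQ diag_mx_row.
  by congr (block_mx _ _ _ _); apply/matrixP => i j; rewrite !mxE !ord1.
exists (P *m H), (row_mx a%:M lam : 'rV_(1 + n)); split.
  by rewrite trmx_mul mulmxA -(mulmxA P) HH mulmx1.
by rewrite trmx_mul -PBP /B !mulmxA.
Qed.

(** * Monotonicity of the symmetric functions of the eigenvalues *)

(** The matrix determinant lemma, by eliminating in the bordered matrix with
    blocks 1, y, - x, diag d in two ways. *)
Lemma det_add_rank1 {F : fieldType} {n : nat} (d : 'rV[F]_n) (x : 'cV[F]_n)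
    (y : 'rV[F]_n) : (forall i, d 0 i != 0) ->
  \det (diag_mx d + x *m y) =
  (1 + \sum_i y 0 i * (d 0 i)^-1 * x i 0) * \prod_i d 0 i.
Proof.
move=> d0; pose D := diag_mx d; pose Di := diag_mx (map_mx GRing.inv d).
have DiD : Di *m D = 1%:M.
  rewrite mulmx_diag -diag_const_mx; congr diag_mx.
  by apply/rowP => i; rewrite !mxE mulVf.
pose M := block_mx (1%:M : 'M[F]_1) y (- x) D.
have detM1 : \det M = \det (D + x *m y).
  have := congr1 determinant (mulmx_block 1%:M y (- x) D 1%:M (- y) 0 1%:M).
  rewrite det_mulmx det_ublock !det1 !mulr1 -/M => ->.
  rewrite !(mulmx1, mul1mx, mulmx0, mul0mx, addr0, add0r) addNr.
  by rewrite mulNmx mulmxN opprK det_lblock det1 mul1r addrC.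
have detM2 : \det M = \det (1%:M + y *m Di *m x) * \det D.
  have := congr1 determinant
    (mulmx_block 1%:M (- (y *m Di)) 0 1%:M 1%:M y (- x) D).
  rewrite det_mulmx det_ublock !det1 !mul1r -/M => ->.
  rewrite !(mulmx1, mul1mx, mulmx0, mul0mx, addr0, add0r).
  rewrite mulNmx mulmxN opprK mulNmx -(mulmxA y Di D) DiD mulmx1 addrN.
  by rewrite det_lblock.
rewrite -detM1 detM2 det_diag det_mx11 !mxE eqxx; congr ((_ + _) * _).
apply: eq_bigr => i _; congr (_ * _).
rewrite !mxE (bigD1 i)//= big1 => [|j ji]; rewrite !mxE ?eqxx ?addr0 //.
by rewrite (negPf ji) mulr0n mulr0.
Qed.

(** Clearing denominators extends the formula from fields to polynomial rings,
    the case in which it is applied. *)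
Lemma det_add_rank1_idom {F : idomainType} {n : nat} (d : 'rV[F]_n)
    (x : 'cV[F]_n) (y : 'rV[F]_n) : (forall i, d 0 i != 0) ->
  \det (diag_mx d + x *m y) =
  \prod_i d 0 i + \sum_i y 0 i * x i 0 * \prod_(j in [set~ i]) d 0 j.
Proof.
move=> d0; apply/eqP; rewrite -tofrac_eq; apply/eqP.
rewrite -det_map_mx map_mxD map_diag_mx map_mxM det_add_rank1; last first.
  by move=> i; rewrite mxE tofrac_eq0.
rewrite mulrDl mul1r rmorphD rmorph_prod rmorph_sum /=; congr (_ + _).
  by apply: eq_bigr => i _; rewrite mxE.
rewrite mulr_suml; apply: eq_bigr => i _.
rewrite !mxE !rmorphM rmorph_prod (bigD1 i)//= mxE.
rewrite [X in _ = _ * X](eq_bigl (fun j => j != i)) => [|j]; last first.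
  by rewrite !inE.
under [in LHS]eq_bigr do rewrite mxE.
by rewrite mulrACA mulfVK ?tofrac_eq0// mulrA.
Qed.

(** One expression that covers both the characteristic polynomial (a = 'X and
    b = -1) and the generating function of the symmetric functions of the
    eigenvalues (a = 1 and b = 'X). *)
Definition detlin {F : comNzRingType} {n : nat} (a b : {poly F}) (A : 'M[F]_n)
  : {poly F} := \det (a%:M + b *: map_mx polyC A).

Lemma detlin_conj {F : comNzRingType} {n : nat} (a b : {poly F})
    (A Q : 'M[F]_n) :
  Q *m Q^T = 1%:M -> detlin a b (Q *m A *m Q^T) = detlin a b A.
Proof.
move=> QQ; rewrite /detlin.
have QQ' : map_mx polyC Q *m map_mx polyC Q^T = 1%:M.
  by rewrite -map_mxM QQ map_mx1.
have -> : a%:M + b *: map_mx polyC (Q *m A *m Q^T) = map_mx polyC Q *m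
    (a%:M + b *: map_mx polyC A) *m map_mx polyC Q^T.
  rewrite mulmxDr mulmxDl scalar_mxC -(mulmxA a%:M) QQ' mulmx1; congr (_ + _).
  by rewrite -scalemxAr -scalemxAl !map_mxM.
rewrite !det_mulmx mulrAC.
have := congr1 determinant QQ'; rewrite det_mulmx det1 => ->.
by rewrite mul1r.
Qed.

Lemma detlin_diag {F : comNzRingType} {n : nat} (a b : {poly F})
    (lam : 'rV[F]_n) :
  detlin a b (diag_mx lam) = \prod_i (a + b * (lam 0 i)%:P).
Proof.
rewrite /detlin map_diag_mx -diag_const_mx -linearZ -linearD det_diag.
by apply: eq_bigr => i _; rewrite !mxE.
Qed.

Section SymmetricFunctions.
Context {R : realType} {n : nat}.
Implicit Types (A : 'M[R]_n) (lam : 'rV[R]_n).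

Lemma S_esf k lam : S_ k lam = esf lam [set: 'I_n] k.
Proof.
rewrite /S_ /esf esf_polyE coef_sum big_mkcond /=.
rewrite [RHS](eq_bigl xpredT); last by move=> J; rewrite finset.subsetT.
apply: eq_bigr => J _; rewrite coefZ coefXn eq_sym.
by case: eqP => _; rewrite ?mulr1 ?mulr0.
Qed.

Lemma esf_poly_perm lam (mu : 'rV[R]_n) :
  \prod_(i < n) ('X - (lam 0 i)%:P) = \prod_(i < n) ('X - (mu 0 i)%:P) ->
  esf_poly lam [set: 'I_n] = esf_poly mu [set: 'I_n].
Proof.
move=> h; pose sl := [seq lam 0 i | i <- index_enum 'I_n].
pose sm := [seq mu 0 i | i <- index_enum 'I_n].
have perm : perm_eq sl sm.
  apply: prod_XsubC_eq; rewrite /sl /sm !big_map; exact: h.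
have E (nu : 'rV[R]_n) : esf_poly nu [set: 'I_n] =
    \prod_(a <- [seq nu 0 i | i <- index_enum 'I_n]) (1 + a *: 'X).
  by rewrite big_map; apply: eq_bigl => i; rewrite inE.
exact: etrans (E lam) (etrans (perm_big _ perm) (Logic.eq_sym (E mu))).
Qed.

(** The sum of the principal minors of size k: for symmetric A the symmetric
    function of its eigenvalues, but defined without choosing them. *)
Definition sigma A k : R := (detlin 1 'X A)`_k.

Lemma detlin_esf A Q lam : Q *m Q^T = 1%:M -> Q *m A *m Q^T = diag_mx lam ->
  detlin 1 'X A = esf_poly lam [set: 'I_n].
Proof.
move=> QQ QA; rewrite -(detlin_conj _ _ _ _ QQ) QA detlin_diag.
by apply: eq_big => i; rewrite ?inE// mulrC mul_polyC.
Qed.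

Lemma S_eigenvalues A k : A^T = A -> S_ k (eigenvalues A) = sigma A k.
Proof.
move=> symA; have [Q [lam [QQ QA]]] := sym_spectral A symA.
have cA : char_poly A = \prod_(i < n) ('X - (lam 0 i)%:P).
  have -> : char_poly A = detlin 'X (-1) A.
    by rewrite /char_poly /char_poly_mx /detlin scaleN1r.
  rewrite -(detlin_conj _ _ _ _ QQ) QA detlin_diag.
  by apply: eq_bigr => i _; rewrite mulN1r.
have eigA : char_poly A = \prod_(i < n) ('X - (eigenvalues A 0 i)%:P).
  by apply: (@xgetPex _ 0 [set mu : 'rV[R]_n |
    char_poly A = \prod_(i < n) ('X - (mu 0 i)%:P)]%classic); exists lam.
have := esf_poly_perm (eigenvalues A) lam (etrans (Logic.eq_sym eigA) cA).
by rewrite S_esf /sigma (detlin_esf A Q lam)// /esf => ->.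
Qed.

(** Here lam lists the eigenvalues of A and y the coordinates of z in an
    orthonormal eigenbasis. *)
Lemma sigma_rank1 A (c : R) (z : 'rV[R]_n) : A^T = A ->
  exists (lam y : 'rV[R]_n),
    [/\ forall k, sigma A k = esf lam [set: 'I_n] k,
        z != 0 -> y != 0 &
        forall k, sigma (A + c *: (z^T *m z)) k.+1 = sigma A k.+1 +
          c * \sum_i y 0 i ^+ 2 * esf lam ([set: 'I_n] :\ i) k].
Proof.
move=> symA; have [Q [lam [QQ QA]]] := sym_spectral A symA.
have QQ' : Q^T *m Q = 1%:M by exact: mulmx1C.
pose y := z *m Q^T; exists lam, y; split.
- by move=> k; rewrite /sigma (detlin_esf A Q lam).
- by apply: contra_neq => y0; rewrite -[z]mulmx1 -QQ' mulmxA -/y y0 mul0mx.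
move=> k; rewrite {1}/sigma -(detlin_conj _ _ _ _ QQ) mulmxDr mulmxDl QA.
rewrite -scalemxAr -scalemxAl mulmxA -[Q *m _ *m _ *m _]mulmxA -/y.
have -> : Q *m z^T = y^T by rewrite /y trmx_mul trmxK.
pose d : 'rV[{poly R}]_n := \row_i (1 + lam 0 i *: 'X).
have -> : detlin 1 'X (diag_mx lam + c *: (y^T *m y)) =
    \det (diag_mx d + ('X * c%:P) *: map_mx polyC y^T *m map_mx polyC y).
  rewrite /detlin map_mxD map_mxZ scalerDr addrA scalerA map_mxM scalemxAl.
  congr (\det (_ + _)); apply/matrixP => i j; rewrite !mxE.
  case: eqP => [->|_]; rewrite ?mulr0n ?mulr1n ?raddf0 ?mulr0 ?addr0//.
  by rewrite mulrC mul_polyC.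
rewrite det_add_rank1_idom; last first.
  move=> i; rewrite mxE; apply/eqP => /(congr1 (fun p : {poly R} => p`_0))/eqP.
  by rewrite coefD coefZ coefX mulr0 addr0 coefC coef0 oner_eq0.
have -> : \prod_i d 0 i = detlin 1 'X A.
  rewrite (detlin_esf A Q lam)// /esf_poly.
  by apply: eq_big => i; rewrite ?inE// mxE.
rewrite coefD -/(sigma A k.+1); congr (_ + _).
have -> : \sum_i (map_mx polyC y) 0 i * (('X * c%:P) *: map_mx polyC y^T) i 0 *
      \prod_(j in [set~ i]) d 0 j =
    'X * (c *: \sum_i (y 0 i ^+ 2) *: esf_poly lam ([set: 'I_n] :\ i)).
  rewrite scaler_sumr mulr_sumr; apply: eq_bigr => i _; rewrite !mxE.
  rewrite -!mul_polyC /esf_poly polyC_exp.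
  have -> : \prod_(j in [set~ i]) d 0 j =
      \prod_(j in [set: 'I_n] :\ i) (1 + lam 0 j *: 'X).
    by apply: eq_big => j; rewrite ?inE ?andbT// mxE.
  by move: (\prod_(j in _) _) => p; ring.
rewrite coefXM coefZ coef_sum; congr (_ * _).
by apply: eq_bigr => i _; rewrite coefZ.
Qed.

End SymmetricFunctions.

Section Monotonicity.
Context {R : realType} {n : nat}.
Implicit Types (A B : 'M[R]_n).

Definition garding_cone (m : nat) A : Prop :=
  forall k, (1 <= k <= m)%N -> 0 < sigma A k.

Lemma sigma_rank1_lt A c (z : 'rV[R]_n) m k : A^T = A -> garding_cone m A ->
  0 < c -> z != 0 -> (1 <= k <= m)%N ->
  sigma A k < sigma (A + c *: (z^T *m z)) k.
Proof.
move=> symA gA c0 z0; have [lam [y [sA y0 sAz]]] := sigma_rank1 A c z symA.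
case: k => // k km; rewrite sAz ltrDl mulr_gt0 //.
have ge0 i : 0 < esf lam ([set: 'I_n] :\ i) k.
  by apply: (@esf_garding _ _ _ _ m) => // j jm; rewrite -sA gA.
have [i yi] : exists i, y 0 i != 0.
  apply/existsP; apply: contraNT (y0 z0); rewrite negb_exists => /forallP h.
  by apply/eqP/rowP => i; rewrite mxE; apply/eqP; rewrite -[_ == _]negbK.
rewrite (bigD1 i)//= ltr_wpDr //.
  by rewrite sumr_ge0 // => j _; rewrite mulr_ge0 ?sqr_ge0 ?ltW.
by rewrite mulr_gt0 // exprn_even_gt0.
Qed.

Lemma sym_rank1 A c (z : 'rV[R]_n) : A^T = A ->
  (A + c *: (z^T *m z))^T = A + c *: (z^T *m z).
Proof. by move=> symA; rewrite linearD linearZ /= trmx_mul trmxK symA. Qed.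

(** Each update keeps the matrix in the cone, so that the next one can be
    applied. *)
Lemma sigma_sum_rank1_lt (I : eqType) A m (s : seq I) (c : I -> R)
    (z : I -> 'rV[R]_n) :
  A^T = A -> garding_cone m A -> s != [::] ->
  (forall i, i \in s -> 0 < c i /\ z i != 0) ->
  forall k, (1 <= k <= m)%N ->
  sigma A k < sigma (A + \sum_(i <- s) c i *: ((z i)^T *m z i)) k.
Proof.
elim: s A => // i s IH A symA gA _ pos k km.
have [ci zi] := pos i (mem_head _ _).
have lt1 j jm := @sigma_rank1_lt A (c i) (z i) m j symA gA ci zi jm.
rewrite big_cons addrA; have [->|s0] := eqVneq s [::].
  by rewrite big_nil addr0 lt1.
apply: (lt_trans (lt1 _ km)); apply: IH => //; first exact: sym_rank1.
- by move=> j jm; apply: (lt_trans _ (lt1 _ jm)); exact: gA.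
- by move=> j js; apply: pos; rewrite in_cons js orbT.
Qed.

(** The spectral decomposition writes B - A as a sum of rank-one updates with
    positive weights. *)
Theorem sigma_mono A B m k : A^T = A -> B^T = B -> garding_cone m A ->
  (0 < n)%N ->
  (forall z : 'rV[R]_n, z != 0 -> 0 < (z *m (B - A) *m z^T) 0 0) ->
  (1 <= k <= m)%N -> sigma A k < sigma B k.
Proof.
move=> symA symB gA n0 pos km.
have symP : (B - A)^T = B - A by rewrite linearB /= symA symB.
have [Q [d [QQ QP]]] := sym_spectral _ symP.
have QQ' : Q^T *m Q = 1%:M by exact: mulmx1C.
have PE : B - A = \sum_(i < n) d 0 i *: ((row i Q)^T *m row i Q).
  have -> : B - A = Q^T *m diag_mx d *m Q.
    by rewrite -QP !mulmxA QQ' mul1mx -mulmxA QQ' mulmx1.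
  apply/matrixP => a b; rewrite summxE mxE; apply: eq_bigr => i _.
  by rewrite mul_mx_diag !mxE big_ord1 !mxE; ring.
rewrite -[B](subrK A) addrC PE.
rewrite (_ : \sum_(i < n) _ = \sum_(i <- index_enum 'I_n)
  d 0 i *: ((row i Q)^T *m row i Q)) //.
apply: (@sigma_sum_rank1_lt _ _ m) => //.
  apply/eqP => e0; have := mem_index_enum (Ordinal n0); by rewrite e0.
move=> i _; have rowQ : (row i Q *m (row i Q)^T) 0 0 = 1.
  have := congr1 (fun X : 'M[R]_n => X i i) QQ; rewrite !mxE eqxx mulr1n => <-.
  by apply: eq_bigr => j _; rewrite !mxE.
have q0 : row i Q != 0 by rewrite -mulmx_tr_eq0 rowQ oner_eq0.
split=> //; suff -> : d 0 i = (row i Q *m (B - A) *m (row i Q)^T) 0 0.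
  exact: pos.
have := congr1 (fun X : 'M[R]_n => X i i) QP; rewrite !mxE eqxx mulr1n => <-.
by rewrite -row_mul; apply: eq_bigr => j _; rewrite !mxE.
Qed.

End Monotonicity.

(** * Calculus in one variable *)

Local Open Scope classical_set_scope.

Section OneVariable.
Context {R : realType}.
Implicit Types f g : R -> R.

(** The mean value theorem on the segment between 0 and a, whatever the sign
    of a. *)
Lemma MVT_centered f (df : R -> R) (a : R) :
  (forall s : R, `|s| <= `|a| -> is_derive s 1 f (df s)) ->
  exists c, `|c| <= `|a| /\ f a - f 0 = a * df c.
Proof.
move=> fdf.
have fc b c : `|b| <= `|a| -> `|c| <= `|a| -> {within `[b, c], continuous f}.
  move=> ba ca; apply: derivable_within_continuous => s.
  rewrite in_itv /= => /andP[bs sc].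
  have sa : `|s| <= `|a|.
    move: ba ca; rewrite !ler_norml => /andP[? ?] /andP[? ?]; apply/andP.
    by split; [apply: le_trans bs|apply: (le_trans sc)].
  by have [] := fdf s sa.
have [a0|a0] := leP 0 a.
  have [s /[!in_itv]/= /andP[s0 sa]||c] := @MVT_segment R f df 0 a a0.
  - by apply: fdf; rewrite !ger0_norm // ltW.
  - by apply: fc; rewrite ?normr0.
  - rewrite in_itv /= => /andP[c0 ca] E; exists c; rewrite !ger0_norm //.
    by rewrite E subr0 mulrC.
have [s /[!in_itv]/= /andP[s0 sa]||c] := @MVT_segment R f df a 0 (ltW a0).
- by apply: fdf; rewrite !ltr0_norm // lerN2 ltW.
- by apply: fc; rewrite ?normr0.
- rewrite in_itv /= => /andP[c0 ca] E; exists c; split.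
    by rewrite !ler0_norm ?lerN2 // ltW.
  by rewrite -opprB E sub0r mulrN opprK mulrC.
Qed.

(** Differentiability is required at the maximum only: this is all that is known
    of u along the transversal curve. *)
Lemma derive_local_max f (d : R) : 0 < d -> derivable f 0 1 ->
  (forall t, `|t| < d -> f t <= f 0) -> 'D_1 f 0 = 0.
Proof.
move=> d0 df fmax; apply/eqP/negPn/negP => D0.
have : (fun h => h^-1 *: (f (h *: 1 + 0) - f 0)) @ 0^' --> 'D_1 f 0 by [].
move/cvgrPdist_lt => /(_ `|'D_1 f 0|).
rewrite normr_gt0 => /(_ D0) [e /= e0 he].
have [t0 [td te]] : 0 < Num.min d e / 2 /\ Num.min d e / 2 < d /\
    Num.min d e / 2 < e.
  split; first by rewrite divr_gt0 // lt_min d0.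
  apply/andP; rewrite -lt_min ltr_pdivrMr // ltr_pMr ?lt_min ?d0 //.
  by rewrite ltr1n.
move: (Num.min d e / 2) t0 td te => t t0 td te.
have step s : `|s| = t -> 'D_1 f 0 * s <= 0.
  move=> st; have s0 : s != 0 by rewrite -normr_gt0 st.
  have := he s; rewrite /ball_ /= sub0r normrN st => /(_ te s0).
  rewrite [s%:A]mulr1 addr0 => h.
  have : f s <= f 0 by apply: fmax; rewrite st.
  rewrite -subr_le0 -[f s - f 0](mulVKf s0) [X in _ <= X -> _]/=.
  move: h; rewrite /GRing.scale /=.
  move: (s^-1 * _) ('D_1 f 0) D0 => q D D0; case: (ltrgt0P D) D0 => // DD _.
    by rewrite ltr_norml; nra.
  by rewrite ltr_norml; nra.
have := step t (gtr0_norm t0); have := step (- t).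
rewrite normrN => /(_ (gtr0_norm t0)) h1 h2.
have /eqP : 'D_1 f 0 * t = 0 by lra.
by rewrite mulf_eq0 (negPf D0) (gt_eqF t0).
Qed.

(** If the second derivative were positive, the first would be positive just
    after 0 and f would increase. *)
Lemma second_derivative_local_max f (df : R -> R) (d ddf : R) : 0 < d ->
  (forall t : R, `|t| < d -> is_derive t 1 f (df t)) ->
  is_derive (0 : R) 1 df ddf ->
  (forall t, `|t| < d -> f t <= f 0) -> ddf <= 0.
Proof.
move=> d0 fdf [dfd dfE] fmax.
have df0 : df 0 = 0.
  have [f0 <-] := fdf 0 (etrans (congr1 (fun x => x < d) (normr0 _)) d0).
  exact: (derive_local_max _ _ d0 f0 fmax).
rewrite leNgt; apply/negP => ddf_gt0.
have : (fun h => h^-1 *: (df (h *: 1 + 0) - df 0)) @ 0^' --> ddf.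
  by rewrite -dfE.
move/cvgrPdist_lt => /(_ _ ddf_gt0) [e /= e0 he].
have pos t : 0 < t -> t < e -> 0 < df t.
  move=> t0 te; have := he t.
  rewrite /ball_ /= sub0r normrN gtr0_norm // => /(_ te).
  rewrite gt_eqF // => /(_ isT).
  rewrite df0 subr0 addr0 /GRing.scale /= mulr1 => h.
  have : 0 < t^-1 * df t.
    by move: h; rewrite ltr_norml; lra.
  by rewrite pmulr_rgt0 ?invr_gt0.
pose t := Num.min d e / 2.
have t0 : 0 < t by rewrite divr_gt0 // lt_min d0.
have [td te] : t < d /\ t < e.
  have : t < Num.min d e.
    by rewrite /t ltr_pdivrMr // ltr_pMr ?lt_min ?d0 // ltr1n.
  by rewrite lt_min => /andP.
have [||c /[!in_itv]/= /andP[c0 ct]] := @MVT R f df 0 t t0.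
- move=> x /[!in_itv]/= /andP[x0 xt]; apply: fdf.
  by rewrite gtr0_norm // (lt_trans xt).
- apply: derivable_within_continuous => x /[!in_itv]/= /andP[x0 xt].
  have [] // : is_derive x 1 f (df x).
  by apply: fdf; rewrite ger0_norm // (le_lt_trans xt).
rewrite subr0 => E.
have := fmax t; rewrite gtr0_norm // => /(_ td); rewrite -subr_le0 E.
by rewrite leNgt mulr_gt0 ?pos // (lt_trans ct).
Qed.

End OneVariable.

Section Space.
Context {R : realType} {n : nat}.
Implicit Types (x y z h v : 'rV[R]_n) (w : 'rV[R]_n -> R) (U : set 'rV[R]_n).

Lemma coord_le_norm x i : `|x 0 i| <= `|x|.
Proof.
by rewrite [leRHS]/Num.norm/= mx_normrE; exact: (le_bigmax _ _ (0, i)).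
Qed.

Lemma norm_le_coord x c : 0 <= c -> (forall i, `|x 0 i| <= c) -> `|x| <= c.
Proof.
move=> c0 xc; rewrite /Num.norm/= mx_normrE; apply: bigmax_le => // -[i j] _.
by rewrite /= ord1.
Qed.

Lemma near0_norm_lt (r : R) : 0 < r -> \forall h \near (0 : 'rV[R]_n), `|h| < r.
Proof.
move=> r0; apply/nbhs_ballP; exists r => //= h.
by rewrite -ball_normE /ball_ /= sub0r normrN.
Qed.

Definition dotv x y : R := \sum_i x 0 i * y 0 i.

Lemma dotv_le x y : `|dotv x y| <= (\sum_i `|y 0 i|) * `|x|.
Proof.
rewrite (le_trans (ler_norm_sum _ _ _)) // mulr_suml ler_sum // => i _.
by rewrite normrM mulrC ler_wpM2l // coord_le_norm.
Qed.

Lemma dotv_is_linear y : linear (dotv^~ y : 'rV[R]_n -> R^o).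
Proof.
move=> a u v; rewrite /dotv /GRing.scale /= mulr_sumr -big_split /=.
by apply: eq_bigr => i _; rewrite !mxE mulrDl mulrA.
Qed.

Lemma line_is_derive w y v s : derivable w (s *: v + y) v ->
  is_derive s 1 (fun t => w (t *: v + y)) ('D_v w (s *: v + y)).
Proof.
have E :
  (fun h : R => h^-1 *: (w ((h *: (1 : R) + s) *: v + y) - w (s *: v + y)))
    = (fun h : R => h^-1 *: (w (h *: v + (s *: v + y)) - w (s *: v + y))).
  apply/funext => h; congr (_ *: (w _ - _)).
  by rewrite [_%:A]mulr1 scalerDl addrA.
move=> dw; apply: DeriveDef; rewrite /derivable /derive /=.
  by rewrite /shift /= E.
by rewrite /shift /= E.
Qed.

Lemma partial_cat s1 s2 w : partial (s1 ++ s2) w = partial s1 (partial s2 w).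
Proof. by rewrite /partial foldr_cat. Qed.

Lemma is_Ck_leq k j U w : (j <= k)%N -> is_Ck k U w -> is_Ck j U w.
Proof.
move=> jk Cw s; have [c d] := Cw s; split=> sj.
  by apply: c; exact: leq_trans jk.
by apply: d; exact: leq_trans jk.
Qed.

Lemma is_Ck_subset k U U' w : U' `<=` U -> is_Ck k U w -> is_Ck k U' w.
Proof.
move=> sub Cw s; have [c d] := Cw s; split=> sk.
  by move=> x /[!inE] xU; apply: c; rewrite ?inE //; exact: sub.
by move=> i x /sub; exact: d.
Qed.

Lemma is_Ck_partial k U w i : is_Ck k.+1 U w -> is_Ck k U (partial [:: i] w).
Proof.
move=> Cw s; have [c d] := Cw (s ++ [:: i]).
rewrite -partial_cat; split=> sk; [apply: c|apply: d];
  by rewrite size_cat addn1.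
Qed.

Lemma is_Ck_partial_continuous k U w s x : is_Ck k U w -> (size s <= k)%N ->
  U x -> {for x, continuous (partial s w)}.
Proof. by move=> Cw sk Ux; have [c _] := Cw s; apply: c; rewrite ?inE. Qed.

Lemma C1_derivable U w i x : is_Ck 1 U w -> U x -> derivable w x (basis_vec i).
Proof. by move=> Cw Ux; have [_ d] := Cw [::]; exact: d. Qed.

Lemma norm_basis_vec_le1 (i : 'I_n) : `|basis_vec i : 'rV[R]_n| <= 1.
Proof.
apply: norm_le_coord => // k; rewrite !mxE.
by case: (_ && _); rewrite ?normr1 ?normr0.
Qed.

Definition grad w x : 'rV[R]_n := \row_i partial [:: i] w x.

Lemma coord_MVT U w y i a :
  is_Ck 1 U w -> (forall s, `|s| <= `|a| -> U (s *: basis_vec i + y)) ->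
  exists c, `|c| <= `|a| /\
    w (a *: basis_vec i + y) - w y =
      a * partial [:: i] w (c *: basis_vec i + y).
Proof.
move=> Cw Uy.
have [s sa|c [ca E]] := @MVT_centered R (fun t => w (t *: basis_vec i + y))
    (fun t => partial [:: i] w (t *: basis_vec i + y)) a.
  by apply: line_is_derive; apply: (C1_derivable _ _ _ _ Cw); exact: Uy.
by exists c; split=> //; rewrite -E scale0r add0r.
Qed.

(** Move from x to h + x one coordinate at a time, with the mean value theorem
    on each step. *)
Lemma C1_estimate U w x (e : R) : open U -> is_Ck 1 U w -> U x -> 0 < e ->
  \forall h \near (0 : 'rV[R]_n),
    `|w (h + x) - w x - dotv h (grad w x)| <= e * `|h|.
Proof.
move=> oU Cw Ux e0.
pose e' := e / n.+1%:R; have e'0 : 0 < e' by rewrite divr_gt0.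
have nU : \forall y \near x, U y by exact: open_nbhs_nbhs.
have nd : \forall y \near x, forall i : 'I_n,
    `|partial [:: i] w x - partial [:: i] w y| < e'.
  apply: (@filter_forall _ _ (fun (i : 'I_n) y =>
    `|partial [:: i] w x - partial [:: i] w y| < e') _ (nbhs_filter x)) => i.
  have : {for x, continuous (partial [:: i] w)}.
    exact: (@is_Ck_partial_continuous 1 U).
  by move/cvgrPdist_lt; apply.
have /nbhs_ballP[r /= r0] : \forall y \near x, U y /\ forall i : 'I_n,
    `|partial [:: i] w x - partial [:: i] w y| < e' by near=> y; split; near: y.
rewrite -ball_normE /ball_ /= => hr.
near=> h; have hlt : `|h| < r by near: h; exact: near0_norm_lt.
(* the first k coordinates of h *)
pose T k : 'rV[R]_n := \row_i (if (i < k)%N then h 0 i else 0).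
have step (k : 'I_n) : `|w (T k.+1 + x) - w (T k + x) -
    h 0 k * partial [:: k] w x| <= e' * `|h|.
  have TS : T k.+1 + x = h 0 k *: basis_vec k + (T k + x).
    rewrite addrA; congr (_ + _).
    apply/rowP => j; rewrite !mxE /= ltnS leq_eqVlt.
    case: (eqVneq j k) => [->|jk]; first by rewrite eqxx ltnn mulr1 addr0.
    by rewrite (negPf (jk : nat_of_ord j != k)) mulr0 add0r.
  have near_x s : `|s| <= `|h 0 k| ->
      `|x - (s *: basis_vec k + (T k + x))| < r.
    move=> sh; rewrite [T k + x]addrC addrCA opprD addNKr normrN.
    apply: le_lt_trans hlt; apply: norm_le_coord => // j; rewrite !mxE /=.
    case: (eqVneq j k) => [->|jk].
      by rewrite ltnn mulr1 addr0 (le_trans sh) // coord_le_norm.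
    by rewrite mulr0 add0r; case: ifP => _; rewrite ?normr0 ?coord_le_norm.
  have Us s : `|s| <= `|h 0 k| -> U (s *: basis_vec k + (T k + x)).
    by move=> /near_x /hr [].
  have [c [ch]] := @coord_MVT U w (T k + x) k (h 0 k) Cw Us.
  rewrite -TS => ->; rewrite -mulrBr normrM mulrC ler_pM //.
    by rewrite distrC ltW //; apply: (hr _ (near_x _ ch)).2.
  exact: coord_le_norm.
have -> : w (h + x) - w x - dotv h (grad w x) = \sum_(k < n)
    (w (T k.+1 + x) - w (T k + x) - h 0 k * partial [:: k] w x).
  rewrite sumrB /dotv; congr (_ - _); last first.
    by apply: eq_bigr => i _; rewrite mxE.
  rewrite -(big_mkord xpredT (fun k => w (T k.+1 + x) - w (T k + x))).
  rewrite telescope_sumr //; congr (w (_ + _) - w _).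
    by apply/rowP => i; rewrite mxE ltn_ord.
  by rewrite -[LHS]add0r; congr (_ + _); apply/rowP => i; rewrite !mxE.
rewrite (le_trans (ler_norm_sum _ _ _)) //.
rewrite (@le_trans _ _ (\sum_(k < n) e' * `|h|)) //.
  by apply: ler_sum => k _; exact: step.
rewrite sumr_const card_ord -mulr_natl mulrA ler_wpM2r // /e'.
by rewrite mulrCA ler_piMr // ?(ltW e0) // ler_pdivrMr // mul1r ler_nat.
Unshelve. all: by end_near. Qed.

Lemma C1_differentiable_derive U w x : open U -> is_Ck 1 U w -> U x ->
  differentiable w x /\ forall v, 'D_v w x = dotv v (grad w x).
Proof.
move=> oU Cw Ux; pose g := grad w x.
pose lin := GRing.isLinear.Build _ _ _ _ _ (dotv_is_linear g).
pose L : {linear 'rV[R]_n -> R^o} := HB.pack (dotv^~ g : 'rV[R]_n -> R^o) lin.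
have Lc : continuous (L : 'rV[R]_n -> R^o).
  apply/linear_bounded_continuous/linear_boundedP.
  have := nbhs_pinfty_ge (num_real (\sum_i `|g 0 i|)).
  apply: filterS => M gM v.
  by rewrite (le_trans (dotv_le v g)) // ler_wpM2r.
have E : (w : 'rV[R]_n -> R^o) \o shift x = cst (w x) + L +o_ (0 : 'rV[R]_n) id.
  apply/eqaddoE/eqaddoP => e e0; near=> h; rewrite /= !fctE /= opprD addrA.
  by near: h; exact: (C1_estimate U).
have dE : 'd (w : 'rV[R]_n -> R^o) x = L :> (_ -> _) by exact: diff_unique.
have dw : differentiable (w : 'rV[R]_n -> R^o) x.
  by apply/diff_locallyP; rewrite dE.
by split=> // v; rewrite deriveE // dE.
Unshelve. all: by end_near. Qed.

End Space.

(** * Second derivatives in several variables *)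

Section Space2.
Context {R : realType} {n : nat}.
Implicit Types (x y z h v p : 'rV[R]_n) (w : 'rV[R]_n -> R) (U : set 'rV[R]_n).

Lemma dotvC x y : dotv x y = dotv y x.
Proof. by apply: eq_bigr => i _; rewrite mulrC. Qed.

Lemma dotvDl x y z : dotv (x + y) z = dotv x z + dotv y z.
Proof.
by rewrite /dotv -big_split; apply: eq_bigr => i _; rewrite mxE mulrDl.
Qed.

Lemma dotvZl a x z : dotv (a *: x) z = a * dotv x z.
Proof.
by rewrite /dotv mulr_sumr; apply: eq_bigr => i _; rewrite mxE mulrA.
Qed.

Lemma near_open U x : open U -> U x ->
  \forall h \near (0 : 'rV[R]_n), U (h + x).
Proof.
move=> oU Ux; have /nbhs_ballP[r /= r0] : nbhs x U by exact: open_nbhs_nbhs.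
rewrite -ball_normE /ball_ /= => sub.
near=> h; apply: sub => /=; rewrite opprD addrCA subrr addr0 normrN.
by near: h; exact: near0_norm_lt.
Unshelve. all: by end_near. Qed.

Lemma near_line (P : set 'rV[R]_n) v :
  (\forall h \near (0 : 'rV[R]_n), P h) ->
  exists2 d : R, 0 < d & forall t, `|t| < d -> P (t *: v).
Proof.
move=> /nbhs_ballP[r /= r0]; rewrite -ball_normE /ball_ /= => sub.
exists (r / (`|v| + 1)); first by rewrite divr_gt0 // ltr_wpDl.
move=> t td; apply: sub => /=; rewrite sub0r normrN normrZ.
have v1 : 0 < `|v| + 1 by rewrite ltr_wpDl.
move: td; rewrite ltr_pdivlMr //; apply: le_lt_trans.
by rewrite ler_wpM2l // lerDl.
Qed.

Lemma is_derive_sumf (I : finType) (f : I -> R -> R) (df : I -> R) (t : R) :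
  (forall i, is_derive t 1 (f i) (df i)) ->
  is_derive t 1 (fun s => \sum_i f i s) (\sum_i df i).
Proof.
move=> fdf.
have H (s : seq I) :
    is_derive t 1 (fun r => \sum_(i <- s) f i r) (\sum_(i <- s) df i).
  elim: s => [|i s IH].
    rewrite big_nil.
    rewrite (_ : (fun _ => _) = cst (0 : R)); first exact: is_derive_cst.
    by apply/funext => r; rewrite big_nil.
  rewrite big_cons.
  rewrite (_ : (fun _ => _) = f i + (fun r => \sum_(i <- s) f i r)).
    exact: is_deriveD.
  by apply/funext => r; rewrite big_cons.
exact: H.
Qed.

(** Two applications of the mean value theorem to the second difference over a
    parallelogram; its symmetry in i and j yields [schwarz]. *)
Lemma mixed_difference U w x i j (e : R) : open U -> is_Ck 2 U w -> U x ->
  0 < e -> exists2 d : R, 0 < d & forall t, `|t| < d ->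
    `| w (t *: basis_vec j + (t *: basis_vec i + x)) - w (t *: basis_vec j + x)
       - w (t *: basis_vec i + x) + w x - t ^+ 2 * partial [:: i; j] w x |
    <= t ^+ 2 * e.
Proof.
move=> oU Cw Ux e0.
have C1w : is_Ck 1 U w by exact: is_Ck_leq Cw.
have C1jw : is_Ck 1 U (partial [:: j] w) by exact: is_Ck_partial.
have nU : \forall y \near x, U y by exact: open_nbhs_nbhs.
have nd : \forall y \near x,
    `|partial [:: i; j] w x - partial [:: i; j] w y| < e.
  have : {for x, continuous (partial [:: i; j] w)}.
    exact: (@is_Ck_partial_continuous R n 2 U).
  by move/cvgrPdist_lt; apply.
have /nbhs_ballP[r /= r0] : \forall y \near x, U y /\
    `|partial [:: i; j] w x - partial [:: i; j] w y| < e.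
  by near=> y; split; near: y.
rewrite -ball_normE /ball_ /= => hr.
exists (r / 2); first by rewrite divr_gt0.
move=> t tr.
have near_x c d : `|c| <= `|t| -> `|d| <= `|t| ->
    `|x - (c *: basis_vec i + (d *: basis_vec j + x))| < r.
  move=> ct dt; rewrite addrA [_ + x]addrC opprD addNKr normrN.
  rewrite (le_lt_trans (ler_normD _ _)) // (splitr r) ltr_leD //.
    rewrite normrZ (le_lt_trans _ tr) // (le_trans _ ct) // ler_piMr //.
    by rewrite norm_basis_vec_le1.
  rewrite normrZ (le_trans _ (ltW tr)) // (le_trans _ dt) // ler_piMr //.
  by rewrite norm_basis_vec_le1.
have Uc c d : `|c| <= `|t| -> `|d| <= `|t| ->
    U (c *: basis_vec i + (d *: basis_vec j + x)).
  by move=> ct dt; have [] := hr _ (near_x _ _ ct dt).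
pose phi s := w (s *: basis_vec j + (t *: basis_vec i + x)) -
  w (s *: basis_vec j + x).
pose dphi s := partial [:: j] w (s *: basis_vec j + (t *: basis_vec i + x)) -
  partial [:: j] w (s *: basis_vec j + x).
have [s st|c [ct E]] := @MVT_centered R phi dphi t.
  apply: is_deriveB; apply: line_is_derive; apply: (C1_derivable _ _ _ _ C1w).
    by rewrite addrCA; exact: Uc.
  by have := Uc 0 s; rewrite normr0 scale0r add0r; apply.
have [s st|d [dt]] :=
    @coord_MVT R n U (partial [:: j] w) (c *: basis_vec j + x) i t C1jw.
  exact: Uc.
rewrite addrCA => E2; move: E; rewrite /phi /dphi E2 !scale0r !add0r.
set a := partial [:: i] _ _ => E.
rewrite (_ : _ - _ = t ^+ 2 * (a - partial [:: i; j] w x)); last first.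
  have aux (A B C D q p s : R) : A - B - (C - D) = s * (s * p) ->
      A - B - C + D - s ^+ 2 * q = s ^+ 2 * (p - q).
    move=> ABCD; have -> : A - B - C + D = A - B - (C - D) by ring.
    by rewrite ABCD; ring.
  exact: aux E.
rewrite normrM ger0_norm ?sqr_ge0 // ler_wpM2l ?sqr_ge0 // distrC ltW //.
by rewrite /a; exact: (hr _ (near_x _ _ dt ct)).2.
Unshelve. all: by end_near. Qed.

Lemma schwarz U w x i j : open U -> is_Ck 2 U w -> U x ->
  partial [:: i; j] w x = partial [:: j; i] w x.
Proof.
move=> oU Cw Ux; apply/eqP; rewrite -subr_eq0 -normr_le0.
apply/ler_addgt0Pl => e e0; rewrite addr0.
have e2 : 0 < e / 2 by rewrite divr_gt0.
have [d1 d10 h1] := @mixed_difference U w x i j (e / 2) oU Cw Ux e2.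
have [d2 d20 h2] := @mixed_difference U w x j i (e / 2) oU Cw Ux e2.
pose t := Num.min d1 d2 / 2.
have t0 : 0 < t by rewrite divr_gt0 // lt_min d10.
have : t < Num.min d1 d2.
  by rewrite /t ltr_pdivrMr // ltr_pMr ?lt_min ?d10 // ltr1n.
rewrite lt_min => /andP[td1 td2].
have := h1 t; rewrite gtr0_norm // => /(_ td1) {}h1.
have := h2 t; rewrite gtr0_norm // => /(_ td2).
rewrite [t *: basis_vec i + (t *: basis_vec j + x)]addrCA => {}h2.
have tt : 0 < t ^+ 2 by rewrite exprn_gt0.
rewrite -(ler_pM2l tt) -{1}(gtr0_norm tt) -normrM.
move: h1 h2; move: (w _) (w _) (w _) (w _) => A B C D.
move: (partial _ _ _) (partial _ _ _) => p q.
rewrite !ler_norml => /andP[? ?] /andP[? ?].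
by apply/andP; split; nra.
Qed.

Lemma hessian_sym U w x : open U -> is_Ck 2 U w -> U x ->
  (hessian w x)^T = hessian w x.
Proof.
move=> oU Cw Ux; apply/matrixP => i j.
by rewrite !mxE (schwarz _ _ _ _ _ oU Cw).
Qed.

Lemma C1_line U w v y t : open U -> is_Ck 1 U w -> U (t *: v + y) ->
  is_derive t 1 (fun s => w (s *: v + y)) (dotv v (grad w (t *: v + y))).
Proof.
move=> oU Cw Uy; have [dw dE] := C1_differentiable_derive _ _ _ oU Cw Uy.
by rewrite -dE; apply: line_is_derive; exact: diff_derivable.
Qed.

Lemma C2_line U w v y t : open U -> is_Ck 2 U w -> U (t *: v + y) ->
  is_derive t 1 (fun s => dotv v (grad w (s *: v + y)))
    ((v *m hessian w (t *: v + y) *m v^T) 0 0).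
Proof.
move=> oU Cw Uy.
have -> : (v *m hessian w (t *: v + y) *m v^T) 0 0 =
    \sum_j v 0 j * dotv v (grad (partial [:: j] w) (t *: v + y)).
  rewrite mxE; apply: eq_bigr => j _; rewrite !mxE mulrC; congr (_ * _).
  by apply: eq_bigr => i _; rewrite !mxE.
have -> : (fun s => dotv v (grad w (s *: v + y))) =
    (fun s => \sum_j v 0 j * partial [:: j] w (s *: v + y)).
  by apply/funext => s; apply: eq_bigr => j _; rewrite mxE.
apply: is_derive_sumf => j.
have H := C1_line U _ v y t oU (is_Ck_partial _ _ _ j Cw) Uy.
exact: (is_deriveZ (v 0 j)).
Qed.

Lemma is_derive_quadratic (a b c t : R) :
  is_derive t 1 (fun s => a + b * s + c * s ^+ 2) (b + 2 * c * t).
Proof.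
have h1 : is_derive t 1 (cst a : R -> R) 0 by exact: is_derive_cst.
have h2 := is_deriveZ b (is_derive_id t (1 : R)).
have h3 := is_deriveZ c (is_deriveX 2 (is_derive_id t (1 : R))).
have := is_deriveD (is_deriveD h1 h2) h3.
rewrite /GRing.scale /= !mulr1 add0r.
have -> : cst a + b \*: id + c \*: id ^+ 2 =
    (fun s : R => a + b * s + c * s ^+ 2).
  by apply/funext => s; rewrite !fctE /GRing.scale.
by have -> : b + c * (2 * t ^+ 1) = b + 2 * c * t by ring.
Qed.

(** The condition is that of w1 - w2 + c |y|^2 + y . p; along the line through x
    in direction z the last two terms are a quadratic polynomial. *)
Lemma second_order_max U w1 w2 x p (c : R) : open U -> is_Ck 2 U w1 ->
  is_Ck 2 U w2 -> U x ->
  (\forall h \near (0 : 'rV[R]_n),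
    w1 (h + x) - w2 (h + x) + c * dotv (h + x) (h + x) + dotv (h + x) p
      <= w1 x - w2 x + c * dotv x x + dotv x p) ->
  forall z, (z *m hessian w1 x *m z^T) 0 0 + 2 * c * dotv z z
    <= (z *m hessian w2 x *m z^T) 0 0.
Proof.
move=> oU C1 C2 Ux xmax z.
have nP : \forall h \near (0 : 'rV[R]_n), U (h + x) /\
   w1 (h + x) - w2 (h + x) + c * dotv (h + x) (h + x) + dotv (h + x) p
     <= w1 x - w2 x + c * dotv x x + dotv x p.
  by near=> h; split; near: h => //; exact: near_open.
have [d d0 dP] := near_line _ z nP.
pose a := c * dotv x x + dotv x p; pose b := 2 * c * dotv z x + dotv z p.
pose g t := w1 (t *: z + x) - w2 (t *: z + x) +
  (a + b * t + c * dotv z z * t ^+ 2).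
have gE t : g t = w1 (t *: z + x) - w2 (t *: z + x) +
    c * dotv (t *: z + x) (t *: z + x) + dotv (t *: z + x) p.
  rewrite /g /a /b !(dotvDl, dotvZl, dotvC _ (_ + _)) [dotv x z]dotvC; ring.
pose dg t := dotv z (grad w1 (t *: z + x)) - dotv z (grad w2 (t *: z + x)) +
  (b + 2 * (c * dotv z z) * t).
have Ux0 : U (0 *: z + x) by rewrite scale0r add0r.
rewrite -subr_le0.
apply: (@second_derivative_local_max R g dg d _ d0).
- move=> t /dP[Ut _]; apply: is_deriveD; last exact: is_derive_quadratic.
  by apply: is_deriveB; apply: (C1_line _ _ _ _ _ oU) => //;
    [exact: is_Ck_leq C1|exact: is_Ck_leq C2].
- have : is_derive (0 : R) 1 dg ((z *m hessian w1 (0 *: z + x) *m z^T) 0 0 -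
      (z *m hessian w2 (0 *: z + x) *m z^T) 0 0 + 2 * (c * dotv z z)).
    apply: is_deriveD; first by apply: is_deriveB; apply: (C2_line U).
    have := is_derive_quadratic b (2 * (c * dotv z z)) 0 0.
    rewrite !mulr0 addr0 (_ : (fun _ => _) =
      (fun t => b + 2 * (c * dotv z z) * t)) //.
    by apply/funext => t; rewrite mul0r addr0.
  have rearrange (a1 a2 a3 : R) : a1 - a2 + 2 * (c * a3) = a1 + 2 * c * a3 - a2.
    by ring.
  by rewrite scale0r add0r rearrange.
- move=> t /dP[_]; rewrite !gE scale0r add0r; exact.
Unshelve. all: by end_near. Qed.

End Space2.

(** * Curves, charts and tangent vectors *)

Section Curves.
Context {R : realType} {n : nat}.
Implicit Types (x y z h v p : 'rV[R]_n) (w : 'rV[R]_n -> R) (U : set 'rV[R]_n).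

Lemma near0_abs_lt (e : R) : 0 < e -> \forall s \near (0 : R), `|s| < e.
Proof.
move=> e0; apply/nbhs_ballP; exists e => //= s.
by rewrite /ball /= sub0r normrN.
Qed.

Lemma continuous_at_sum (T : topologicalType) (I : finType) (f : I -> T -> R)
    (t : T) : (forall i, {for t, continuous (f i)}) ->
  {for t, continuous (fun s => \sum_i f i s)}.
Proof.
move=> fc; apply: (@cvg_big R I +%R 0 xpredT _ T (nbhs t) (index_enum I) f
  (fun i => f i t)).
  exact: add_continuous.
by move=> i _; exact: fc.
Qed.

Lemma is_derive_coord (g : R -> 'rV[R]_n) (t : R) (i : 'I_n) :
  derivable g t 1 -> is_derive t 1 (fun s => g s 0 i) (derive1 g t 0 i).
Proof.
move=> dg; apply: DeriveDef; first by have /derivable_mxP := dg; apply.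
by rewrite derive1E derive_mx // mxE.
Qed.

Lemma is_derive_dotv (g : R -> 'rV[R]_n) (t : R) p : derivable g t 1 ->
  is_derive t 1 (fun s => dotv (g s) p) (dotv (derive1 g t) p).
Proof.
move=> dg; apply: is_derive_sumf => i.
have := is_deriveZ (p 0 i) (is_derive_coord g t i dg).
rewrite /GRing.scale /= mulrC; congr (is_derive _ _ _ _).
by apply/funext => s; rewrite mulrC.
Qed.

Lemma is_derive_dotvv (g : R -> 'rV[R]_n) (t : R) : derivable g t 1 ->
  is_derive t 1 (fun s => dotv (g s) (g s)) (2 * dotv (derive1 g t) (g t)).
Proof.
move=> dg; rewrite /dotv mulr_sumr; apply: is_derive_sumf => i.
have H := is_derive_coord g t i dg.
apply: (is_derive_eq (is_deriveM H H)); rewrite /GRing.scale /=; ring.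
Qed.

Lemma is_derive_curve U w (g : R -> 'rV[R]_n) (t : R) : open U ->
  is_Ck 1 U w -> derivable g t 1 -> U (g t) ->
  is_derive t 1 (fun s => w (g s)) (dotv (derive1 g t) (grad w (g t))).
Proof.
move=> oU Cw dg Ug; have [dw dE] := C1_differentiable_derive _ _ _ oU Cw Ug.
have dg' : differentiable g t by apply/derivable1_diffP.
have dc : differentiable ((w : 'rV[R]_n -> R^o) \o g) t.
  exact: differentiable_comp.
apply: DeriveDef; first exact: diff_derivable.
rewrite deriveE // diff_comp //= -dE deriveE //; congr ('d _ _ _).
by rewrite diff1E // scale1r.
Qed.

Lemma continuous_at_coord (g : R -> 'rV[R]_n) (t : R) :
  (forall i, {for t, continuous (fun s => g s 0 i)}) -> {for t, continuous g}.
Proof.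
move=> gc; apply/cvgrPdist_lt => e e0.
have e2 : 0 < e / 2 by rewrite divr_gt0.
have : \forall s \near t, forall i : 'I_n, `|g t 0 i - g s 0 i| < e / 2.
  apply: (@filter_forall _ _ (fun (i : 'I_n) s => `|g t 0 i - g s 0 i| < e / 2)
    _ (nbhs_filter t)) => i.
  by have /cvgrPdist_lt := gc i; apply.
apply: filterS => s hs; rewrite (@le_lt_trans _ _ (e / 2)) //; last first.
  by rewrite ltr_pdivrMr // ltr_pMr // ltr1n.
by apply: norm_le_coord => [|i]; rewrite ?ltW // !mxE hs.
Qed.

(** The Lipschitz bound on the gradient turns the mean value theorem along the
    segment from x to h + x into a quadratic remainder. *)
Lemma C11_estimate U w x : open U -> is_Ck_holder 1 1 U w -> U x ->
  exists C : R, \forall h \near (0 : 'rV[R]_n),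
    `|w (h + x) - w x - dotv h (grad w x)| <= C * `|h| ^+ 2.
Proof.
move=> oU [Cw Hw] Ux.
have lip (i : 'I_n) : exists C : R, \forall h \near (0 : 'rV[R]_n),
    `|partial [:: i] w (h + x) - partial [:: i] w x| <= C * `|h|.
  have [r [C [r0 hC]]] := Hw [:: i] erefl x Ux.
  exists C; near=> h.
  have := hC (h + x) x; rewrite addrK powRr1 //; apply => //.
  - by near: h; exact: near_open.
  - rewrite -ball_normE /ball_ /= opprD addrCA subrr addr0 normrN.
    by near: h; exact: near0_norm_lt.
  - exact: ballxx.
have [C hC] := fin_all_exists lip.
have : \forall h \near (0 : 'rV[R]_n), U (h + x) /\ forall i : 'I_n,
    `|partial [:: i] w (h + x) - partial [:: i] w x| <= C i * `|h|.
  near=> h; split; first by near: h; exact: near_open.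
  near: h; exact: (@filter_forall _ _ (fun (i : 'I_n) h =>
    `|partial [:: i] w (h + x) - partial [:: i] w x| <= C i * `|h|)
    _ (nbhs_filter _) hC).
move=> /nbhs_ballP[r /= r0]; rewrite -ball_normE /ball_ /= => hr.
exists (\sum_i `|C i|); near=> h.
have hlt : `|h| < r by near: h; exact: near0_norm_lt.
have nch (c : R) : `|c| <= `|1 : R| -> `|c *: h| <= `|h|.
  by rewrite normr1 normrZ => c1; rewrite ler_piMl.
have inr (c : R) : `|c| <= `|1 : R| -> `|0 - c *: h| < r.
  by move=> c1; rewrite sub0r normrN (le_lt_trans (nch _ c1)).
have [s s1|c [c1]] := @MVT_centered R (fun s => w (s *: h + x))
    (fun s => dotv h (grad w (s *: h + x))) 1.
  apply: C1_line => //; first exact: oU.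
  by have [] := hr _ (inr _ s1).
rewrite scale1r scale0r add0r mul1r => ->.
rewrite /dotv -sumrB (le_trans (ler_norm_sum _ _ _)) // mulr_suml.
apply: ler_sum => i _; rewrite !mxE -mulrBr normrM expr2 mulrCA.
rewrite ler_pM // ?coord_le_norm //.
apply: (le_trans ((hr _ (inr _ c1)).2 i)).
rewrite (le_trans (ler_wpM2r (normr_ge0 _) (ler_norm (C i)))) //.
by rewrite ler_wpM2l // nch.
Unshelve. all: by end_near. Qed.

(** The curve is the preimage of a straight segment in the chart.  Its velocity
    is z because differentiating Psi (Phi (t z + x)) = t z + x at t = 0 shows that
    the differential of Psi inverts that of Phi. *)
Lemma tangent_of_annihilated (l : nat) (M U V : set 'rV[R]_n)
    (Phi Psi : 'rV[R]_n -> 'rV[R]_n) x z :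
  open U -> open V -> U x -> M x ->
  (forall y, U y -> V (Phi y) /\ Psi (Phi y) = y) ->
  (forall y, V y -> U (Psi y) /\ Phi (Psi y) = y) ->
  is_C11_map U Phi -> is_C11_map V Psi ->
  (forall y, U y -> (M y <-> forall i : 'I_n, (l <= i)%N -> Phi y 0 i = 0)) ->
  (forall i : 'I_n, (l <= i)%N -> dotv z (grad (fun y => Phi y 0 i) x) = 0) ->
  tangent_space M x z.
Proof.
move=> oU oV Ux Mx UV VU CPhi CPsi MU zann.
have CPhi1 i : is_Ck 1 U (fun y => Phi y 0 i) by case: (CPhi i).
have CPsi1 i : is_Ck 1 V (fun y => Psi y 0 i) by case: (CPsi i).
pose eta : 'rV[R]_n := \row_i dotv z (grad (fun y => Phi y 0 i) x).
pose c t := Psi (t *: eta + Phi x).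
have [Vx Psix] := UV _ Ux.
have [d d0 dV] := near_line _ eta (near_open _ _ oV Vx).
have cE (i : 'I_n) (t : R) : `|t| < d -> is_derive t 1 (fun s => c s 0 i)
    (dotv eta (grad (fun y => Psi y 0 i) (t *: eta + Phi x))).
  by move=> td; apply: (C1_line V) => //; exact: dV.
have dc (t : R) : `|t| < d -> derivable c t 1.
  by move=> td; apply/derivable_mxP => i j; rewrite ord1; have [] := cE j t td.
have c'E (t : R) (i : 'I_n) : `|t| < d -> derive1 c t 0 i =
    dotv eta (grad (fun y => Psi y 0 i) (t *: eta + Phi x)).
  move=> td; have [_ <-] := is_derive_coord c t i (dc t td).
  by have [_ <-] := cE i t td.
exists d, c; split=> //; split.
  move=> t td; have [Ut PhiE] := VU _ (dV t td); split.
  - apply/(MU _ Ut) => i li; rewrite PhiE !mxE zann // mulr0 add0r.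
    by have /(MU _ Ux) := Mx; apply.
  - exact: dc.
  apply: continuous_at_coord => i.
  have near_d : \forall s \near t, `|s| < d.
    have : {for t, continuous (fun s : R => `|s|)} by exact: norm_continuous.
    by move/cvgr_lt; apply.
  suff H : {for t, continuous (fun s : R =>
      dotv eta (grad (fun y => Psi y 0 i) (s *: eta + Phi x)))}.
    rewrite /prop_for /continuous_at. rewrite c'E //; apply: cvg_trans H.
    apply: near_eq_cvg; near=> s; rewrite c'E //; near: s; exact: near_d.
  apply: continuous_at_sum => j; apply: cvgMl_tmp.
  rewrite (_ : (fun _ => _) =
    partial [:: j] (fun y => Psi y 0 i) \o (fun s : R => s *: eta + Phi x)).
    rewrite mxE; apply: continuous_comp.
      by apply: cvgD; [apply: cvgZr_tmp; exact: cvg_id|exact: cvg_cst].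
    by apply: (@is_Ck_partial_continuous R n 1 V) => //; exact: dV.
  by apply/funext => s; rewrite mxE.
split; first by rewrite /c scale0r add0r.
apply/rowP => i; rewrite c'E ?normr0 // scale0r add0r.
have [e e0 eU] := near_line _ z (near_open _ _ oU Ux).
pose b t := Phi (t *: z + x).
have bE j : is_derive (0 : R) 1 (fun s => b s 0 j) (eta 0 j).
  have := @C1_line R n U (fun y => Phi y 0 j) z x 0 oU (CPhi1 j).
  by rewrite scale0r add0r mxE; apply.
have db : derivable b 0 1.
  by apply/derivable_mxP => k j; rewrite ord1; have [] := bE j.
have b'E : derive1 b 0 = eta.
  apply/rowP => j; have [_ <-] := is_derive_coord b 0 j db.
  by have [_ <-] := bE j.
have b0 : b 0 = Phi x by rewrite /b scale0r add0r.
have := is_derive_curve V _ b 0 oV (CPsi1 i) db; rewrite b0 b'E.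
move=> /(_ Vx)[_ <-].
rewrite (@near_eq_derive _ _ _ _ (fun s : R => s * z 0 i + x 0 i)); last first.
  near=> s; have /UV[_ PsiPhi] : U (s *: z + x).
    by apply: eU; near: s; exact: near0_abs_lt.
  by rewrite /b PsiPhi !mxE.
have [_ ->//] : is_derive (0 : R) 1 (fun s : R => s * z 0 i + x 0 i) (z 0 i).
have := is_derive_quadratic (x 0 i) (z 0 i) 0 0.
rewrite !mulr0 addr0; congr (is_derive _ _ _ _).
by apply/funext => s; rewrite mul0r addr0 addrC mulrC.
Unshelve. all: by end_near. Qed.

End Curves.

(** * The comparison principle *)

Lemma powR_invnK {R : realType} (m : nat) (a : R) : (0 < m)%N -> 0 < a ->
  (a `^ m%:R^-1) `^ m%:R = a.
Proof.
move=> m0 a0; rewrite -powRrM mulVf; first by rewrite powRr1 ?ltW.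
by rewrite pnatr_eq0 -lt0n.
Qed.

Section Comparison.
Context {R : realType} {n : nat}.
Implicit Types (x y z h v p : 'rV[R]_n) (U : set 'rV[R]_n).

(** The m-th root is injective on positive reals, so equal values of F_m would
    contradict the strict monotonicity of S_m. *)
Lemma F_neq_of_lt (m : nat) (A B : 'M[R]_n) : (1 <= m <= n)%N ->
  A^T = A -> B^T = B ->
  (forall k, (1 <= k <= m)%N -> 0 < S_ k (eigenvalues A)) ->
  (forall k, (1 <= k <= m)%N -> 0 < S_ k (eigenvalues B)) ->
  (forall z, z != 0 -> 0 < (z *m (B - A) *m z^T) 0 0) ->
  F_ m A <> F_ m B.
Proof.
move=> /andP[m0 mn] symA symB posA posB BA.
have mm : (1 <= m <= m)%N by rewrite m0 /=.
have coneA : garding_cone m A.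
  by move=> k km; rewrite -S_eigenvalues //; exact: posA.
have := sigma_mono _ _ m m symA symB coneA (leq_trans m0 mn) BA mm.
rewrite -(S_eigenvalues A m symA) -(S_eigenvalues B m symB) => ltAB FAB.
move: ltAB; rewrite -(powR_invnK m (S_ m (eigenvalues A)) m0 (posA _ mm)).
rewrite -(powR_invnK m (S_ m (eigenvalues B)) m0 (posB _ mm)).
by move: FAB; rewrite /F_ => ->; rewrite ltxx.
Qed.

(** At such a maximum D^2 w2 - D^2 w1 >= 2 c I, which F_m detects. *)
Lemma no_interior_max (m : nat) (f w1 w2 : 'rV[R]_n -> R) U x p (c : R) :
  (1 <= m <= n)%N -> open U -> U x -> 0 < c ->
  admissible_solution m f U w1 -> admissible_solution m f U w2 ->
  ~ (\forall h \near (0 : 'rV[R]_n),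
    w1 (h + x) - w2 (h + x) + c * dotv (h + x) (h + x) + dotv (h + x) p
      <= w1 x - w2 x + c * dotv x x + dotv x p).
Proof.
move=> hm oU Ux c0 [[C1 adm1] F1] [[C2 adm2] F2] xmax.
have second := second_order_max U w1 w2 x p c oU C1 C2 Ux xmax.
apply: (F_neq_of_lt m _ _ hm (hessian_sym U w1 x oU C1 Ux)
  (hessian_sym U w2 x oU C2 Ux) (adm1 x Ux) (adm2 x Ux)); last first.
  exact: etrans (F1 x Ux) (Logic.eq_sym (F2 x Ux)).
move=> z z0; rewrite mulmxBr mulmxBl mxE [X in _ + X]mxE subr_gt0.
apply: lt_le_trans (second z); rewrite ltrDl mulr_gt0 ?mulr_gt0 //.
by rewrite /dotv -mulmx_trE mulmx_tr_gt0.
Qed.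

Lemma continuous_dotv p : continuous (fun y => dotv y p).
Proof.
move=> y; apply: continuous_at_sum => i; apply: cvgMr_tmp.
  exact: (nbhs_filter y).
exact: (@coord_continuous R 1 n 0 i y).
Qed.

Lemma continuous_dotvv : continuous (fun y : 'rV[R]_n => dotv y y).
Proof.
move=> y; apply: continuous_at_sum => i; apply: cvgM.
- exact: (nbhs_filter y).
- exact: (@coord_continuous R 1 n 0 i y).
- exact: (@coord_continuous R 1 n 0 i y).
Qed.

(** Recentring half of the quadratic perturbation at x leaves the other half and
    an affine function. *)
Lemma dotv_recenter (e t : R) x y p :
  e * dotv y y + (- (e / 2 * dotv (y - x) (y - x)) + t * dotv (y - x) p) =
  e / 2 * dotv y y + (dotv y (e *: x + t *: p) +
    - (e / 2 * dotv x x + t * dotv x p)).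
Proof.
have dotvBl a b c : dotv (a - b) c = dotv a c - dotv b c.
  by rewrite -scaleN1r dotvDl dotvZl mulN1r.
have dotvBr a b c : dotv a (b - c) = dotv a b - dotv a c.
  by rewrite dotvC dotvBl !(dotvC a).
have dotvDr a b c : dotv a (b + c) = dotv a b + dotv a c.
  by rewrite dotvC dotvDl !(dotvC a).
have dotvZr a b r : dotv a (r *: b) = r * dotv a b.
  by rewrite dotvC dotvZl (dotvC a).
rewrite !dotvBl !dotvBr dotvDr !dotvZr (dotvC x y).
by move: (dotv _ _) (dotv _ _) (dotv _ _) (dotv _ _) (dotv _ _) => *; field.
Qed.

Lemma sqr_norm_le_dotv y : `|y| ^+ 2 <= dotv y y.
Proof.
have dotv_ge0 : 0 <= dotv y y.
  by apply: sumr_ge0 => i _; rewrite -expr2 sqr_ge0.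
rewrite -(ler_sqrt _ dotv_ge0) sqrtr_sqr normr_id.
apply: norm_le_coord => [|i]; first exact: sqrtr_ge0.
rewrite -sqrtr_sqr ler_sqrt // /dotv (bigD1 i) //= -expr2 lerDl.
by apply: sumr_ge0 => j _; rewrite -expr2 sqr_ge0.
Qed.

Lemma compact_closure (Omega : set 'rV[R]_n) : bounded_set Omega ->
  compact (closure Omega).
Proof.
move=> [M [Mreal OM]]; apply: bounded_closed_compact; last exact: closed_closure.
exists M; split=> // N MN x clx.
apply/ler_addgt0Pr => e e0.
have [y [Oy xy]] := clx _ (nbhsx_ballx x e e0).
move: xy; rewrite -ball_normE /ball_ /= => /ltW xy.
have yN : `|y| <= N := OM N MN y Oy.
by rewrite -[x](subrK y) addrC (le_trans (ler_normD _ _)) // lerD.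
Qed.

(** By [tangent_of_annihilated] some defining function of M has a differential p
    that does not annihilate c'.  It vanishes on M, so its linear part is as
    small there as its C^{1,1} remainder. *)
Lemma transversal_normal (l : nat) (M : set 'rV[R]_n) x (c' : 'rV[R]_n) :
  C11_submanifold l M -> M x -> ~ tangent_space M x c' ->
  exists p (C : R), dotv c' p != 0 /\
    \forall h \near (0 : 'rV[R]_n), M (h + x) -> `|dotv h p| <= C * `|h| ^+ 2.
Proof.
move=> hM Mx ntan.
have [U [V [Phi [Psi [[oU oV Ux] [UV [VU [CPhi [CPsi MU]]]]]]]]] := hM x Mx.
have [i [li ni]] : exists i : 'I_n, (l <= i)%N /\
    dotv c' (grad (fun y => Phi y 0 i) x) != 0.
  apply: contrapT => none; apply: ntan.
  apply: (tangent_of_annihilated l M U V Phi Psi) => // i li.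
  by apply/eqP; apply: contrapT => /negP ni; apply: none; exists i.
have [C hC] := C11_estimate U _ x oU (CPhi i) Ux.
exists (grad (fun y => Phi y 0 i) x), C; split=> //; near=> h => Mh.
have Uh : U (h + x) by near: h; exact: near_open.
have P1 : Phi (h + x) 0 i = 0 by apply: (proj1 (MU _ Uh)).
have P2 : Phi x 0 i = 0 by apply: (proj1 (MU _ Ux)).
have : `|Phi (h + x) 0 i - Phi x 0 i -
    dotv h (grad (fun y => Phi y 0 i) x)| <= C * `|h| ^+ 2 by near: h.
by rewrite P1 P2 subrr sub0r normrN.
Unshelve. all: by end_near. Qed.

(** Symmetric in the two functions: it applies to (u, v) and to (v, u). *)
Lemma comparison (m l : nat) (Omega E M : set 'rV[R]_n)
    (f w1 w2 : 'rV[R]_n -> R) :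
  (1 <= m <= n)%N -> open Omega -> bounded_set Omega ->
  C11_submanifold l M -> closed E -> E `<=` M ->
  admissible_solution m f (Omega `\` E) w1 ->
  admissible_solution m f (Omega `\` E) w2 ->
  {within closure Omega, continuous w1} ->
  {within closure Omega, continuous w2} ->
  (forall x, boundary Omega x -> w1 x = w2 x) ->
  (forall x, E x -> Omega x ->
     differentiable_along_transversal_curve M (fun y => w1 y - w2 y) x) ->
  forall x, closure Omega x -> w1 x <= w2 x.
Proof.
move=> hm oO bO hM cE EM sol1 sol2 cw1 cw2 bdry hcurve xb Oxb.
rewrite leNgt; apply/negP => w_lt.
pose K := closure Omega; have cK : compact K by exact: compact_closure.
have K0 : K !=set0 by exists xb.
have oU : open (Omega `\` E) by apply: openI => //; exact: closed_openC.
have cw : {within K, continuous (fun y => w1 y - w2 y)}.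
  by move=> y; apply: (@cvgB _ R^o); [exact: cw1|exact: cw2].
have [yq Kyq qmax] := EVT_max_rV K0 cK (continuous_subspaceT continuous_dotvv).
pose Q := dotv yq yq.
have Q0 : 0 <= Q by apply: le_trans (sqr_norm_le_dotv _); exact: sqr_ge0.
(* eps |y|^2 stays below the value of w1 - w2 at xb, so that the maximum of G is
   not on the boundary *)
pose eps := (w1 xb - w2 xb) / (2 * (Q + 1)).
have eps0 : 0 < eps.
  by rewrite divr_gt0 ?subr_gt0 // mulr_gt0 // ltr_wpDl.
have eps2 : 0 < eps / 2 by rewrite divr_gt0.
have epsQ : eps * Q < w1 xb - w2 xb.
  have -> : w1 xb - w2 xb = eps * (2 * (Q + 1)).
    by rewrite /eps divfK // gt_eqF // mulr_gt0 // ltr_wpDl.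
  by rewrite ltr_pM2l //; lra.
clearbody eps.
pose G y := w1 y - w2 y + eps * dotv y y.
have cG : {within K, continuous G}.
  move=> y; apply: (@cvgD _ R^o); first exact: cw.
  apply: (@cvgMl_tmp R).
  exact: (continuous_subspaceT continuous_dotvv).
have [x0 /[!inE] Kx0 Gmax'] := EVT_max_rV K0 cK cG.
have Gmax y : K y -> G y <= G x0 by move=> Ky; apply: Gmax'; rewrite inE.
have Gpos : w1 xb - w2 xb <= G x0.
  apply: le_trans (Gmax xb Oxb); rewrite /G lerDl mulr_ge0 ?(ltW eps0) //.
  by apply: le_trans (sqr_norm_le_dotv _); exact: sqr_ge0.
have Ox0 : Omega x0.
  apply: contrapT => nOx0.
  have b0 : boundary Omega x0.
    by split=> //; have /interior_id -> := oO.
  have : G x0 <= eps * Q.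
    rewrite /G (bdry _ b0) subrr add0r ler_pM2l //.
    by apply: qmax; rewrite inE.
  by move=> /(le_trans Gpos); rewrite leNgt epsQ.
have OK y : Omega y -> K y by exact: subset_closure.
have Ex0 : E x0.
  apply: contrapT => nEx0.
  apply: (@no_interior_max m f w1 w2 (Omega `\` E) x0 0 eps) => //.
  have dot0 y : dotv y 0 = 0 by apply: big1 => i _; rewrite mxE mulr0.
  near=> h; rewrite !dot0 !addr0; apply: Gmax; apply: OK.
  by near: h; exact: near_open.
have [d [g [d0 [gc [g0 [dg [ntan dwg]]]]]]] := hcurve x0 Ex0 Ox0.
have [p [C [gp hC]]] := transversal_normal l M x0 _ hM (EM _ Ex0) ntan.
have : \forall h \near (0 : 'rV[R]_n), Omega (h + x0) /\
    (M (h + x0) -> `|dotv h p| <= C * `|h| ^+ 2).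
  near=> h; split; last by near: h.
  by near: h; exact: near_open.
move=> /nbhs_ballP[r' /= r'0]; rewrite -ball_normE /ball_ /= => hr'.
pose r := r' / 2; have r0 : 0 < r by rewrite divr_gt0.
have hr h : `|h| <= r -> Omega (h + x0) /\
    (M (h + x0) -> `|dotv h p| <= C * `|h| ^+ 2).
  move=> hr; apply: hr' => /=; rewrite sub0r normrN (le_lt_trans hr) //.
  by rewrite /r ltr_pdivrMr // ltr_pMr // ltr1n.
clearbody r.
pose P := \sum_i `|p 0 i|; have P0 : 0 <= P by exact: sumr_ge0.
(* tau = (eps / 2) / Lam is small enough both for the boundary of the ball,
   where p . h <= P r, and for M, where p . h <= C |h|^2 *)
pose Lam := P / r + `|C| + 1.
have Lam0 : 0 < Lam by rewrite ltr_wpDl // addr_ge0 // divr_ge0 // ltW.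
pose tau := eps / 2 / Lam.
have tau0 : 0 < tau by rewrite /tau divr_gt0 // divr_gt0.
have tauE : tau * Lam = eps / 2 by rewrite /tau divfK // gt_eqF.
have tauP : tau * P <= eps / 2 * r.
  rewrite -tauE -mulrA ler_pM2l // /Lam !mulrDl divfK ?gt_eqF // -addrA lerDl.
  by rewrite addr_ge0 // mulr_ge0 // ltW.
have tauC : tau * C <= eps / 2.
  rewrite -tauE ler_pM2l // /Lam (le_trans (ler_norm C)) //.
  by rewrite addrAC lerDr addr_ge0 // divr_ge0 // ltW.
clearbody tau.
pose G2 y := G y - eps / 2 * dotv (y - x0) (y - x0) + tau * dotv (y - x0) p.
have G2x0 : G2 x0 = G x0.
  have dot0 y : dotv 0 y = 0 by apply: big1 => i _; rewrite mxE mul0r.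
  by rewrite /G2 subrr !dot0 !mulr0 subr0 addr0.
have G2le y : K y -> tau * dotv (y - x0) p <= eps / 2 * `|y - x0| ^+ 2 ->
    G2 y <= G x0.
  move=> Ky le1; rewrite /G2 -addrA -[leRHS]addr0 lerD ?Gmax // addrC subr_le0.
  apply: (le_trans le1); rewrite ler_pM2l //.
  exact: sqr_norm_le_dotv.
have G2E (s : 'rV[R]_n) : G2 s = w1 s - w2 s + eps / 2 * dotv s s +
    dotv s (eps *: x0 + tau *: p) - (eps / 2 * dotv x0 x0 + tau * dotv x0 p).
  by rewrite /G2 /G -!addrA dotv_recenter !addrA.
pose B := [set y | `|y - x0| <= r].
have BO y : B y -> Omega y.
  by move=> By; have := (hr _ By).1; rewrite subrK.
have cB : compact B.
  apply: bounded_closed_compact.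
    exists (`|x0| + r); split; first exact: num_real.
    move=> N rN y By; rewrite /= -[y](subrK x0) addrC.
    by rewrite (le_trans (ler_normD _ _)) // (le_trans _ (ltW rN)) // lerD2l.
  have -> : B = closed_ball x0 r.
    by rewrite closed_ballE //; apply/seteqP; split=> y;
      rewrite /B /closed_ball_ /= distrC.
  exact: closed_ball_closed.
have B0 : B !=set0 by exists x0; rewrite /B /= subrr normr0 ltW.
have cG2 : {within B, continuous G2}.
  have BK : B `<=` K by move=> y /BO /OK.
  have cwB := continuous_subspaceW BK cw.
  rewrite (_ : G2 = fun y => w1 y - w2 y + (eps / 2 * dotv y y +
    dotv y (eps *: x0 + tau *: p) - (eps / 2 * dotv x0 x0 + tau * dotv x0 p))).
    move=> y; apply: (@cvgD _ R^o); first exact: cwB.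
    apply: (@cvgB _ R^o); last exact: cvg_cst.
    apply: (@cvgD _ R^o).
      apply: (@cvgMl_tmp R).
      exact: (continuous_subspaceT continuous_dotvv).
    exact: (continuous_subspaceT (continuous_dotv _)).
  by apply/funext => y; rewrite G2E !addrA.
have [x1 /[!inE] Bx1 G2max'] := EVT_max_rV B0 cB cG2.
have G2max y : B y -> G2 y <= G2 x1 by move=> By; apply: G2max'; rewrite inE.
have G2W : G2 x1 <= G x0.
  (* on the boundary of the ball, and then on E inside it, the quadratic term
     given up by G2 absorbs the tilt *)
  have [x1r|x1r] := ltP `|x1 - x0| r; last first.
    have x1E : `|x1 - x0| = r by apply/eqP; rewrite eq_le x1r andbT; exact: Bx1.
    apply: G2le; first by apply: OK; exact: BO.
    rewrite x1E (le_trans (ler_norm _)) // normrM (gtr0_norm tau0).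
    rewrite (@le_trans _ _ (tau * (P * r))) //.
      by rewrite ler_pM2l // -x1E dotv_le.
    by rewrite mulrA expr2 mulrA ler_pM2r.
  have [Ex1|nEx1] := pselect (E x1).
    apply: G2le; first by apply: OK; exact: BO.
    have := (hr _ Bx1).2; rewrite subrK => /(_ (EM _ Ex1)) le1.
    rewrite (le_trans (ler_norm _)) // normrM (gtr0_norm tau0).
    rewrite (@le_trans _ _ (tau * (C * `|x1 - x0| ^+ 2))) //.
      by rewrite ler_pM2l.
    by rewrite mulrA ler_wpM2r // sqr_ge0.
  exfalso; apply: (@no_interior_max m f w1 w2 (Omega `\` E) x1
    (eps *: x0 + tau *: p) (eps / 2)) => //.
  - by split=> //; exact: BO.
  have rx1 : 0 < r - `|x1 - x0| by rewrite subr_gt0.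
  near=> h; have hlt : `|h| < r - `|x1 - x0| by near: h; exact: near0_norm_lt.
  have := G2max (h + x1); rewrite !G2E lerD2r; apply.
  by rewrite /B /= -addrA (le_trans (ler_normD _ _)) // -lerBrDr ltW.
have [d1 d10 gB] : exists2 d1 : R, 0 < d1 & forall t, `|t| < d1 -> B (g t).
  have : {for 0, continuous g} by apply: gc; rewrite normr0.
  move/cvgrPdist_lt => /(_ r r0) /nbhs_ballP[d1 /= d10 hd1].
  exists d1 => // t td; have := hd1 t; rewrite /ball /= sub0r normrN => /(_ td).
  by rewrite g0 distrC => /ltW.
have dwg' : derivable (fun t => w1 (g t) - w2 (g t)) 0 1 by exact: dwg.
have dqg := is_derive_dotvv g 0 dg.
set D := 'D_1 (fun t => w1 (g t) - w2 (g t)) 0.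
have dW : is_derive (0 : R) 1 (fun t => w1 (g t) - w2 (g t)) D.
  exact: derivableP.
have dG : is_derive (0 : R) 1 (fun t => G (g t))
    (D + eps *: (2 * dotv (derive1 g 0) (g 0))).
  apply: is_deriveD; exact: (is_deriveZ eps).
have zeroG : D + eps * (2 * dotv (derive1 g 0) (g 0)) = 0.
  have [dG' <-] := dG.
  apply: (@derive_local_max R _ d1 d10) => // t td.
  by rewrite g0; apply: Gmax; apply: OK; apply: BO; exact: gB.
have dG2 : is_derive (0 : R) 1 (fun t => G2 (g t))
    (D + (eps / 2) *: (2 * dotv (derive1 g 0) (g 0)) +
     dotv (derive1 g 0) (eps *: x0 + tau *: p) - 0).
  rewrite (_ : (fun t => _) = fun t => w1 (g t) - w2 (g t) +
    eps / 2 * dotv (g t) (g t) + dotv (g t) (eps *: x0 + tau *: p) -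
    (eps / 2 * dotv x0 x0 + tau * dotv x0 p)); last first.
    by apply/funext => t; rewrite G2E.
  have hK : is_derive (0 : R) 1
      (cst (eps / 2 * dotv x0 x0 + tau * dotv x0 p) : R -> R) 0.
    exact: is_derive_cst.
  have h1 := is_deriveZ (eps / 2) dqg.
  have h2 := is_derive_dotv g 0 (eps *: x0 + tau *: p) dg.
  exact: (is_deriveB (is_deriveD (is_deriveD dW h1) h2) hK).
have zeroG2 : D + (eps / 2) * (2 * dotv (derive1 g 0) (g 0)) +
     dotv (derive1 g 0) (eps *: x0 + tau *: p) = 0.
  have [dG2' E2] := dG2; rewrite subr0 in E2.
  rewrite -[LHS]E2; apply: (@derive_local_max R _ d1 d10) => // t td.
  by rewrite g0 G2x0 (le_trans (G2max _ (gB _ td))).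
have : tau * dotv (derive1 g 0) p = 0.
  move: zeroG zeroG2; rewrite g0.
  rewrite (dotvC _ (_ + _)) dotvDl !dotvZl (dotvC x0) (dotvC p).
  have aux (a b e t s : R) : s + e * (2 * a) = 0 ->
      s + e / 2 * (2 * a) + (e * a + t * b) = 0 -> t * b = 0 by lra.
  exact: aux.
by move/eqP; rewrite mulf_eq0 (gt_eqF tau0) (negPf gp).
Unshelve. all: by end_near. Qed.

End Comparison.

(** * Removability *)

Lemma partial_eq_on {R : realType} {n : nat} (U : set 'rV[R]_n)
    (w1 w2 : 'rV[R]_n -> R) (s : seq 'I_n) : open U ->
  (forall x, U x -> w1 x = w2 x) ->
  forall x, U x -> partial s w1 x = partial s w2 x.
Proof.
move=> oU w12; elim: s => [|i s IH] x Ux; first exact: w12.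
apply: near_eq_derive; near=> y; apply: IH; near: y.
exact: open_nbhs_nbhs.
Unshelve. all: by end_near. Qed.

Lemma is_Ck_eq_on {R : realType} {n : nat} (k : nat) (U : set 'rV[R]_n)
    (w1 w2 : 'rV[R]_n -> R) : open U ->
  (forall x, U x -> w1 x = w2 x) -> is_Ck k U w1 -> is_Ck k U w2.
Proof.
move=> oU w12 C1 s; have [c d] := C1 s.
have near_eq x : U x -> \forall y \near x, partial s w1 y = partial s w2 y.
  move=> Ux; near=> y; apply: (partial_eq_on U) => //; near: y.
  exact: open_nbhs_nbhs.
split=> sk; last first.
  by move=> i x Ux; exact: (near_eq_derivable (near_eq x Ux) (d sk i x Ux)).
move=> x /[!inE] Ux; have {}c := c sk x (mem_set Ux).
rewrite /prop_for /continuous_at -(partial_eq_on U w1) //.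
apply: cvg_trans c; apply: near_eq_cvg; first exact: (nbhs_filter x).
exact: (near_eq x Ux).
Unshelve. all: by end_near. Qed.

Lemma admissible_solution_subset {R : realType} {n : nat} (m : nat)
    (f w : 'rV[R]_n -> R) (U U' : set 'rV[R]_n) : U' `<=` U ->
  admissible_solution m f U w -> admissible_solution m f U' w.
Proof.
move=> sub [[C adm] F]; split; last by move=> x /sub; exact: F.
by split; [exact: is_Ck_subset C|move=> x /sub; exact: adm].
Qed.

Theorem corollary3p9 (R : realType) (n m k l : nat) (alpha : R)
  (Omega E M : set 'rV[R]_n) (f u v : 'rV[R]_n -> R)
  (hOmega : domain Omega)
  (hm : (1 <= m <= n)%N)
  (hk : (2 <= k)%N)
  (halpha : 0 < alpha < 1)
  (hfpos : forall x, Omega x -> 0 < f x)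
  (hf : is_Ck_holder k alpha Omega f)
  (hln : (l < n)%N)
  (hM : C11_submanifold l M)
  (hEclosed : closed E)
  (hEM : E `<=` M)
  (hEOmega : compactly_contained E Omega)
  (hu : admissible_solution m f (Omega `\` E) u)
  (hucont : {within closure Omega, continuous u})
  (hv : dirichlet_solution m f Omega u v)
  (hcurve : forall x, E x -> differentiable_along_transversal_curve M u x) :
  (forall x, closure Omega x -> u x = v x) /\ is_Ck 2 Omega u.
Proof.
have [oO _ bO] := hOmega; have [vsol vcont vbdry] := hv.
have vsolE : admissible_solution m f (Omega `\` E) v.
  by apply: admissible_solution_subset vsol => x [].
have C1v : is_Ck 1 Omega v by apply: is_Ck_leq vsol.1.1.
have curve x : E x -> Omega x ->
    differentiable_along_transversal_curve M (fun y => u y - v y) x /\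
    differentiable_along_transversal_curve M (fun y => v y - u y) x.
  move=> Ex Ox; have [d [g [d0 [gc [g0 [dg [ntan dug]]]]]]] := hcurve x Ex.
  have [dvg _] := is_derive_curve Omega v g 0 oO C1v dg (eq_ind_r Omega Ox g0).
  split; refine (ex_intro _ d (ex_intro _ g (conj d0 (conj gc (conj g0
    (conj dg (conj ntan _))))))).
    exact: (derivableB dug dvg).
  exact: (derivableB dvg dug).
have uv : forall x, closure Omega x -> u x = v x.
  move=> x Ox; apply/eqP; rewrite eq_le; apply/andP; split.
    apply: (comparison m l Omega E M f u v) => //.
    - by move=> y yb; rewrite vbdry.
    - by move=> y Ey Oy; have [] := curve y Ey Oy.
  apply: (comparison m l Omega E M f v u) => //.
  by move=> y Ey Oy; have [] := curve y Ey Oy.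
split=> //; apply: (is_Ck_eq_on 2 Omega v u oO); last exact: vsol.1.1.
by move=> x Ox; rewrite uv //; exact: subset_closure.
Qed.
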